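(* There exists an efficient algorithm which, given $\epsilon\in(0,1)$ and sample access to two unknown product distributions $P,Q$ over $\{0,1\}^n$, takes $O\big(\max(\sqrt n/\epsilon^2,\ n^{3/4}/\epsilon)\big)$ samples from $P$ and $Q$, and distinguishes with probability at least $2/3$ between (i) $\|P-Q\|_1=0$ and (ii) $\|P-Q\|_1>\epsilon$.
   Context: A product distribution over $\{0,1\}^n$ is one with independent coordinates. $\|P-Q\|_1=\sum_x|P(x)-Q(x)|$. Distinguishing means: accept with probability at least $2/3$ in case (i), reject with probability at least $2/3$ in case (ii). *)

(* Defs.v *)
From HB Require Import structures.
From mathcomp Require Import all_boot all_order all_algebra.
From mathcomp Require Import boolp reals exp.

Set Implicit Arguments.
Unset Strict Implicit.
Unset Printing Implicit Defensive.

Import Order.TTheory GRing.Theory Num.Theory.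

(* Algorithms are programs for a random access machine whose unbounded memory
   [nat -> nat] holds natural numbers, under the logarithmic cost criterion:
   producing a value [v] costs its bit length. Charged time is thus polynomially
   related to Turing machine time, although [*] and [/] are primitive.
   The real parameter eps is presented as an oracle for its binary expansion:
   [Approx e] returns floor (2 ^ k * eps), where k is the value of e, and costs
   at least k. *)

Inductive binop := Add | Sub | Mul | Div | Leq.

Inductive expr :=
  | Const of nat
  | Cell of expr
  | Bin of binop & expr & expr
  | Approx of expr.

Inductive source := FromP | FromQ.

(* [Sample src e] draws a fresh sample from P or Q and writes its bits to
   consecutive memory cells starting at address e; [Flip e] writes a fresh fair
   random bit to cell e. *)
Inductive cmd :=
  | Skip
  | Store of expr & expr
  | Sample of source & expr
  | Flip of expr
  | Seq of cmd & cmd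
  | If of expr & cmd & cmd
  | While of expr & cmd.

Definition memory := nat -> nat.

Definition upd (mu : memory) (a v : nat) : memory :=
  fun j => if j == a then v else mu j.

Definition upd_bits (mu : memory) (a : nat) (x : seq bool) : memory :=
  fun j => if a <= j < a + size x then nat_of_bool (nth false x (j - a))
           else mu j.

Definition binop_val (o : binop) (u v : nat) : nat :=
  match o with
  | Add => u + v
  | Sub => u - v
  | Mul => u * v
  | Div => u %/ v
  | Leq => u <= v
  end.

Definition bitlen (v : nat) : nat := (trunc_log 2 v).+1.

Fixpoint eval (orc : nat -> nat) (mu : memory) (e : expr) : nat :=
  match e with
  | Const k => k
  | Cell e1 => mu (eval orc mu e1)
  | Bin o e1 e2 => binop_val o (eval orc mu e1) (eval orc mu e2)
  | Approx e1 => orc (eval orc mu e1)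
  end.

Fixpoint eval_cost (orc : nat -> nat) (mu : memory) (e : expr) : nat :=
  bitlen (eval orc mu e) +
  match e with
  | Const _ => 0
  | Cell e1 => eval_cost orc mu e1
  | Bin _ e1 e2 => eval_cost orc mu e1 + eval_cost orc mu e2
  | Approx e1 => eval_cost orc mu e1 + eval orc mu e1
  end.

(* The random inputs are three tapes, consumed from the left: samples of P,
   samples of Q, fair coins. *)
Record state := State {
  mem : memory;
  tapeP : seq (seq bool);
  tapeQ : seq (seq bool);
  coins : seq bool
}.

(* [exec orc c s t s']: from state s, command c halts in state s' after time t.
   A [Sample] or [Flip] on an exhausted tape never halts. *)
Inductive exec (orc : nat -> nat) : cmd -> state -> nat -> state -> Prop :=
  | ExecSkip s : exec orc Skip s 1 s
  | ExecStore e1 e2 mu p q r :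
      exec orc (Store e1 e2) (State mu p q r)
        (eval_cost orc mu e1 + eval_cost orc mu e2).+1
        (State (upd mu (eval orc mu e1) (eval orc mu e2)) p q r)
  | ExecSampleP e mu x p q r :
      exec orc (Sample FromP e) (State mu (x :: p) q r)
        (eval_cost orc mu e + size x).+1
        (State (upd_bits mu (eval orc mu e) x) p q r)
  | ExecSampleQ e mu p x q r :
      exec orc (Sample FromQ e) (State mu p (x :: q) r)
        (eval_cost orc mu e + size x).+1
        (State (upd_bits mu (eval orc mu e) x) p q r)
  | ExecFlip e mu p q b r :
      exec orc (Flip e) (State mu p q (b :: r))
        (eval_cost orc mu e).+1
        (State (upd mu (eval orc mu e) (nat_of_bool b)) p q r)
  | ExecSeq c1 c2 s1 s2 s3 t1 t2 :
      exec orc c1 s1 t1 s2 -> exec orc c2 s2 t2 s3 ->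
      exec orc (Seq c1 c2) s1 (t1 + t2) s3
  | ExecIfT e c1 c2 s s' t :
      eval orc (mem s) e != 0 -> exec orc c1 s t s' ->
      exec orc (If e c1 c2) s (eval_cost orc (mem s) e + t).+1 s'
  | ExecIfF e c1 c2 s s' t :
      eval orc (mem s) e = 0 -> exec orc c2 s t s' ->
      exec orc (If e c1 c2) s (eval_cost orc (mem s) e + t).+1 s'
  | ExecWhileT e c s1 s2 s3 t1 t2 :
      eval orc (mem s1) e != 0 ->
      exec orc c s1 t1 s2 -> exec orc (While e c) s2 t2 s3 ->
      exec orc (While e c) s1 (eval_cost orc (mem s1) e + t1 + t2).+1 s3
  | ExecWhileF e c s :
      eval orc (mem s) e = 0 ->
      exec orc (While e c) s (eval_cost orc (mem s) e).+1 s.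

Lemma exec_det orc c s t s' t' s'' :
  exec orc c s t s' -> exec orc c s t' s'' -> t = t' /\ s' = s''.
Proof.
move=> H; elim: H t' s'' => {c s t s'}
  [s|e1 e2 mu p q r|e mu x p q r|e mu p x q r|e mu p q b r
  |c1 c2 s1 s2 s3 t1 t2 _ IH1 _ IH2|e c1 c2 s s' t he _ IH|e c1 c2 s s' t he _ IH
  |e c s1 s2 s3 t1 t2 he _ IH1 _ IH2|e c s he] t' s'' H';
  inversion H'; subst => //.
- match goal with A : exec _ c1 _ _ _, B : exec _ c2 _ _ _ |- _ =>
    have [-> E] := IH1 _ _ A; subst; by have [-> ->] := IH2 _ _ B end.
- match goal with A : exec _ c1 _ _ _ |- _ => by have [-> ->] := IH _ _ A end.
- by move: he; match goal with A : eval _ _ e = 0 |- _ => rewrite A end.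
- by match goal with A : is_true (eval _ _ e != 0) |- _ => move: A; rewrite he end.
- match goal with A : exec _ c2 _ _ _ |- _ => by have [-> ->] := IH _ _ A end.
- match goal with A : exec _ c _ _ _, B : exec _ (While e c) _ _ s'' |- _ =>
    have [-> E] := IH1 _ _ A end; subst.
  match goal with B : exec _ (While e c) ?s _ _, D : exec _ c _ _ ?s |- _ =>
   by have [-> ->] := IH2 _ _ B end.
- by move: he; match goal with A : eval _ _ e = 0 |- _ => rewrite A end.
- by match goal with A : is_true (eval _ _ e != 0) |- _ => move: A; rewrite he end.
Qed.

Local Open Scope ring_scope.

Definition eps_oracle (R : realType) (eps : R) (k : nat) : nat :=
  Num.truncn (2 ^+ k * eps).

Notation tapes n m K :=
  (m.-tuple (n.-tuple bool) * m.-tuple (n.-tuple bool) * K.-tuple bool)%type.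

Definition init_state (n m K : nat) (w : tapes n m K) : state :=
  State (upd (fun=> 0%N) 0%N n)
        [seq tval x | x <- tval w.1.1] [seq tval x | x <- tval w.1.2] (tval w.2).

(* Cell 0 is n on entry; on exit it is nonzero iff the algorithm accepts. *)
Definition outcome (R : realType) (A : cmd) (n m K : nat) (eps : R)
    (w : tapes n m K) (t : nat) (b : bool) : Prop :=
  exists2 s, exec (eps_oracle eps) A (init_state w) t s & (mem s 0%N != 0%N) = b.

Definition is_dist (R : realType) (n : nat) (P : {ffun n.-tuple bool -> R}) :=
  (forall x, 0 <= P x) /\ \sum_x P x = 1.

Definition marginal (R : realType) (n : nat) (P : {ffun n.-tuple bool -> R})
    (i : 'I_n) (b : bool) : R :=
  \sum_(x : n.-tuple bool | tnth x i == b) P x.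

Definition product_dist (R : realType) (n : nat)
    (P : {ffun n.-tuple bool -> R}) :=
  is_dist P /\ forall x, P x = \prod_(i < n) marginal P i (tnth x i).

Definition l1_dist (R : realType) (n : nat)
    (P Q : {ffun n.-tuple bool -> R}) : R :=
  \sum_x `|P x - Q x|.

Definition tapes_weight (R : realType) (n m K : nat)
    (P Q : {ffun n.-tuple bool -> R}) (w : tapes n m K) : R :=
  (\prod_(i < m) P (tnth w.1.1 i)) * (\prod_(i < m) Q (tnth w.1.2 i))
    * 2^-1 ^+ K.

(* Probability that A outputs b, on m independent samples from each of P and Q
   and K independent fair coins. *)
Definition out_prob (R : realType) (A : cmd) (n m K : nat) (eps : R)
    (P Q : {ffun n.-tuple bool -> R}) (b : bool) : R :=
  \sum_(w : tapes n m K | `[< exists t, outcome A eps w t b >])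
    tapes_weight P Q w.

(* Main.v *)
Require Import Defs.
From HB Require Import structures.
From mathcomp Require Import all_boot all_order all_algebra.
From mathcomp Require Import boolp reals exp.
From mathcomp Require Import zify ring lra.

Set Implicit Arguments.
Unset Strict Implicit.
Unset Printing Implicit Defensive.

Import Order.TTheory GRing.Theory Num.Theory.

(** Write [p], [q] for the coordinate means, [d = p - q] and
    [b = p + q - 2 p q], the probability that a sample of P and a sample of Q
    disagree in the coordinate. Three independent blocks of [N] samples from
    each distribution are used. The first block gives the weights
    [w = floor ((N + 1) / (V + 1))], where [V] counts the disagreements of the
    coordinate; the other two give independent differences [D], [D'] of the
    numbers of ones. The statistic [T = sum w D D'] has conditional mean
    [N^2 sum w d^2] and conditional variance
    [sum (2 (N^2 w d^2) (w N v) + (w N v)^2)] with [v = b - d^2].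

    Since [V] is binomial, [E w^2 b^2 <= 2], so the noise
    [sum (w N v)^2] is [O (N^2 n)] and Chebyshev's inequality settles the case
    P = Q with the threshold [T <= 3 N sqrt n]. For the far case, put
    [A = sum N d^2 / (N b + 1)], a sum of terms of order [min (d^2 / b, N d^2)].
    Markov's inequality applied to [sum d^2 N^2 (V + 1) / (N b + 1)^2] gives
    [sum w d^2 >= A / 20] with high probability. Finally, split the
    coordinates at [N b = 1]: a Hellinger bound on the heavy ones and
    subadditivity of the L1 distance on the light ones show that
    [A >= eps^2 / 64] or [A >= N eps^2 / (32 n)] when the L1 distance exceeds
    eps, and this beats the noise as soon as [N] is a large multiple of
    [sqrt n / eps^2] and of [n^(3/4) / eps]. *)

(** * Polynomial bounds and their closure properties *)

Lemma leq_bitlen v : bitlen v <= v.+1.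
Proof.
rewrite /bitlen ltnS; case: v => [|v]; first by rewrite trunc_log0.
have := trunc_logP (isT : 1 < 2) (isT : 0 < v.+1).
by have := ltn_expl (trunc_log 2 v.+1) (isT : 1 < 2); lia.
Qed.

(** One number serves as coefficient and degree, so a polynomial bound is a single existential
    witness; for [W >= 1] the family is closed under sums, products and composition. *)
Definition polyb (k W : nat) := k * W ^ k.

Lemma polybD k1 k2 W : 0 < W -> polyb k1 W + polyb k2 W <= polyb (k1 + k2) W.
Proof.
by move=> W0; rewrite /polyb mulnDl leq_add // leq_mul // leq_pexp2l //; lia.
Qed.

Lemma polybM k1 k2 W :
  0 < W -> polyb k1 W * polyb k2 W <= polyb (k1 * k2 + (k1 + k2)) W.
Proof.
move=> W0; rewrite /polyb mulnACA -expnD leq_mul //; first lia.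
by rewrite leq_pexp2l //; lia.
Qed.

Lemma polyb_comp k1 k2 W :
  0 < W -> polyb k1 (polyb k2 W) <= polyb (k1 * k2 ^ k1 + k2 * k1) W.
Proof.
move=> W0; rewrite /polyb expnMn -expnM mulnA leq_mul //; first lia.
by rewrite leq_pexp2l //; lia.
Qed.

Lemma polyb_ge k W : 0 < k -> 0 < W -> k <= polyb k W /\ W <= polyb k W.
Proof.
move=> k0 W0; rewrite /polyb; split; first by rewrite leq_pmulr // expn_gt0 W0.
rewrite -[X in X <= _]mul1n leq_mul // -[X in X <= _]expn1 leq_pexp2l //.
Qed.

(** * Programs and their running time *)

Fixpoint oracle_free (e : expr) : bool :=
  match e with
  | Const _ => true
  | Cell e1 => oracle_free e1
  | Bin _ e1 e2 => oracle_free e1 && oracle_free e2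
  | Approx _ => false
  end.

Lemma binop_val_le o u v : binop_val o u v <= (u + 1) * (v + 1).
Proof.
case: o => /=; [lia|lia|lia|by have := leq_div u v; lia|by case: (u <= v); lia].
Qed.

(** [k] depends on the expression alone. Oracle answers are not bounded by the memory contents,
    hence the restriction to oracle-free expressions. *)
Lemma eval_poly e : oracle_free e ->
  exists2 k, 0 < k & forall orc mu W, 0 < W -> (forall a, mu a <= W) ->
    eval orc mu e <= polyb k W /\ eval_cost orc mu e <= polyb k W.
Proof.
elim: e => [c|e1 IH|o e1 IH1 e2 IH2|//] /=.
- move=> _; exists c.+1 => // orc mu W W0 _.
  have [h1 h2] := polyb_ge (isT : 0 < c.+1) W0.
  by have := leq_bitlen c; lia.
- move=> /IH[k k0 {}IH]; exists (k + 2) => [|orc mu W W0 hmu]; first lia.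
  have [h1 h2] := IH orc mu W W0 hmu.
  have := hmu (eval orc mu e1); have := leq_bitlen (mu (eval orc mu e1)).
  have := polybD k 2 W0; have [h3 h4] := polyb_ge (isT : 0 < 2) W0.
  have : 2 * W <= polyb 2 W by rewrite /polyb leq_mul // expnS leq_pmulr ?expn1.
  by lia.
- case/andP=> /IH1[k1 k10 {}IH1] /IH2[k2 k20 {}IH2].
  pose K := (k1 + 1) * (k2 + 1) + ((k1 + 1) + (k2 + 1)).
  exists (k1 + (k2 + (K + 1))) => [|orc mu W W0 hmu]; first lia.
  have [a1 b1] := IH1 orc mu W W0 hmu; have [a2 b2] := IH2 orc mu W W0 hmu.
  set v := binop_val _ _ _.
  have one : 1 <= polyb 1 W by rewrite /polyb mul1n expn1.
  have hv : v <= polyb K W.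
    apply: leq_trans (binop_val_le _ _ _) _; apply: leq_trans (polybM _ _ W0).
    apply: leq_mul.
      by apply: leq_trans (polybD _ _ W0); rewrite leq_add.
    by apply: leq_trans (polybD _ _ W0); rewrite leq_add.
  have := leq_bitlen v; have := polybD k1 (k2 + (K + 1)) W0.
  by have := polybD k2 (K + 1) W0; have := polybD K 1 W0; lia.
Qed.

Fixpoint straight_line (c : cmd) : bool :=
  match c with
  | Skip => true
  | Store e1 e2 => oracle_free e1 && oracle_free e2
  | Seq c1 c2 => straight_line c1 && straight_line c2
  | _ => false
  end.

(** Functional semantics of straight-line code. Such code has the same effect under every oracle, so
    the zero oracle is fixed; commands outside the fragment get a default value. *)
Fixpoint run (c : cmd) (mu : memory) : memory :=
  match c with
  | Store e1 e2 => upd mu (eval (fun=> 0) mu e1) (eval (fun=> 0) mu e2)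
  | Seq c1 c2 => run c2 (run c1 mu)
  | _ => mu
  end.

Lemma eval_oracle_free e orc orc' mu :
  oracle_free e -> eval orc mu e = eval orc' mu e.
Proof.
by elim: e => //= [e IH /IH -> //|o e1 IH1 e2 IH2 /andP[/IH1 -> /IH2 ->]].
Qed.

Lemma straight_line_poly c : straight_line c ->
  exists2 k, 0 < k & forall orc mu W p q r, 0 < W -> (forall a, mu a <= W) ->
    (forall a, run c mu a <= polyb k W) /\
    exists2 t, exec orc c (State mu p q r) t (State (run c mu) p q r)
             & t <= polyb k W.
Proof.
elim: c => //= [|e1 e2|c1 IH1 c2 IH2].
- move=> _; exists 1 => // orc mu W p q r W0 hmu; rewrite /polyb mul1n expn1.
  by split=> //; exists 1 => //; apply: ExecSkip.
- case/andP=> f1 f2; have [k1 k10 h1] := eval_poly f1.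
  have [k2 k20 h2] := eval_poly f2; exists (k1 + (k2 + 1)) =>
    [|orc mu W p q r W0 hmu].
    lia.
  have [a1 b1] := h1 orc mu W W0 hmu; have [a2 b2] := h2 orc mu W W0 hmu.
  have := polybD k1 (k2 + 1) W0; have := polybD k2 1 W0.
  rewrite [in polyb 1 W]/polyb mul1n expn1 => le1 le2; split.
    move=> a; rewrite /upd (eval_oracle_free _ orc) //.
    rewrite (eval_oracle_free _ orc mu f2).
    by case: ifP => _; [lia | have := hmu a; lia].
  eexists; first by rewrite (eval_oracle_free _ orc mu f1) (eval_oracle_free _
    orc mu f2); apply: ExecStore.
  lia.
- case/andP=> /IH1[k1 k10 {}IH1] /IH2[k2 k20 {}IH2].
  exists (k1 + (k2 * k1 ^ k2 + k1 * k2)) => [|orc mu W p q r W0 hmu]; first lia.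
  have [b1 [t1 x1 le1]] := IH1 orc mu W p q r W0 hmu.
  have [W1 _] := polyb_ge k10 W0.
  have [b2 [t2 x2 le2]] := IH2 orc _ _ p q r (leq_trans k10 W1) b1.
  have := polyb_comp k2 k1 W0; have := polybD k1 (k2 * k1 ^ k2 + k1 * k2) W0.
  move=> A B; split=> [a|]; first by have := b2 a; lia.
  by exists (t1 + t2); [apply: ExecSeq x1 x2 | lia].
Qed.

(** The family [G] indexes all inputs, and one [k] must serve them all: this uniformity is what
    finally makes the running time polynomial. *)
Definition runs (G : Type) (orc : G -> nat -> nat) (W : G -> nat)
    (H : G -> Prop) (c : cmd) (f g : G -> state) :=
  exists k, forall x : G, H x ->
    exists2 t, exec (orc x) c (f x) t (g x) & t <= polyb k (W x).

Section RunsRules.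

Variables (G : Type) (orc : G -> nat -> nat) (W : G -> nat).
Hypothesis W_gt0 : forall x, 0 < W x.

Lemma runs_seq (H : G -> Prop) c1 c2 f g h :
  runs orc W H c1 f g -> runs orc W H c2 g h -> runs orc W H (Seq c1 c2) f h.
Proof.
move=> [k1 h1] [k2 h2]; exists (k1 + k2) => x Hx.
have [t1 e1 l1] := h1 x Hx; have [t2 e2 l2] := h2 x Hx.
exists (t1 + t2); first exact: ExecSeq e1 e2.
by have := polybD k1 k2 (W_gt0 x); lia.
Qed.

Lemma runs_eq (H : G -> Prop) c f g f' g' :
  (forall x, H x -> f x = f' x) -> (forall x, H x -> g x = g' x) ->
  runs orc W H c f g -> runs orc W H c f' g'.
Proof.
move=> Ef Eg [k h]; exists k => x Hx.
by rewrite -Ef // -Eg //; exact: h.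
Qed.

Lemma runs_straight_line (H : G -> Prop) c (mu : G -> memory) p q r :
  straight_line c -> (forall x, H x -> forall a, mu x a <= W x) ->
  runs orc W H c (fun x => State (mu x) (p x) (q x) (r x))
                 (fun x => State (run c (mu x)) (p x) (q x) (r x)).
Proof.
move=> /straight_line_poly[k _ h] hmu; exists k => x Hx.
by have [_] := h (orc x) (mu x) (W x) (p x) (q x) (r x) (W_gt0 x) (hmu x Hx).
Qed.

Lemma runs_sample (H : G -> Prop) src e (mu : G -> memory) p q r z :
  oracle_free e -> (forall x, H x -> forall a, mu x a <= W x) ->
  (forall x, H x -> size (z x) <= W x) ->
  runs orc W H (Sample src e)
    (fun x => State (mu x) (if src is FromP then z x :: p x else p x)
                (if src is FromQ then z x :: q x else q x) (r x))
    (fun x => State (upd_bits (mu x) (eval (fun=> 0) (mu x) e) (z x))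
                (p x) (q x) (r x)).
Proof.
move=> fe hmu hz; have [k k0 h] := eval_poly fe.
exists (k + (1 + 1)) => x Hx.
have [_ le1] := h (orc x) (mu x) (W x) (W_gt0 x) (hmu x Hx).
rewrite (eval_oracle_free _ (orc x)) //.
have := polybD k (1 + 1) (W_gt0 x); have := polybD 1 1 (W_gt0 x).
have := hz x Hx; have := W_gt0 x.
rewrite [in polyb 1 _]/polyb mul1n expn1.
case: src => ? ? ? ?; eexists; [exact: ExecSampleP|lia|exact: ExecSampleQ|lia].
Qed.

(** [I x v] is the exact state after [v] of the [b x] iterations. The body is run over pairs of an
    input and an iteration number, so that all iterations share one time bound. *)
Lemma runs_while (H : G -> Prop) e c (b : G -> nat) (I : G -> nat -> state) kg :
  (forall x, H x -> b x <= W x) ->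
  (forall x v, H x -> v <= b x ->
     (eval (orc x) (Defs.mem (I x v)) e != 0) = (v < b x) /\
     eval_cost (orc x) (Defs.mem (I x v)) e <= polyb kg (W x)) ->
  runs (fun y : G * nat => orc y.1) (fun y => W y.1)
       (fun y => H y.1 /\ y.2 < b y.1) c
       (fun y => I y.1 y.2) (fun y => I y.1 y.2.+1) ->
  runs orc W H (While e c) (fun x => I x 0) (fun x => I x (b x)).
Proof.
move=> bW hg [k hc]; pose K := kg + (k + 1).
(* The guard is evaluated at most [W + 1 <= 2 W ^ 2] times, which is [polyb 2 W]; this is the
   exponent of [polybM 2 K]. *)
exists (2 * K + (2 + K)) => x Hx; have W0 := W_gt0 x.
have unit1 : 1 <= polyb 1 (W x) by rewrite /polyb mul1n expn1.
have sumK := polybD kg (k + 1) W0; rewrite -/K in sumK;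
  have sumk := polybD k 1 W0.
(* Induction on the number [v] of iterations still to come, with [u] already done. *)
suff loop v u : v + u = b x ->
    exists2 t, exec (orc x) (While e c) (I x u) t (I x (b x))
             & t <= v.+1 * polyb K (W x).
  have [t et lt] := loop (b x) 0 (addn0 _); exists t => //.
  apply: leq_trans (polybM _ _ W0); apply: (leq_trans lt); rewrite leq_mul //.
  rewrite /polyb; have := bW x Hx.
  have : W x <= W x ^ 2 by rewrite expnS expn1 leq_pmulr.
  by lia.
elim: v u => [|v IH] u Eu.
  rewrite add0n in Eu; rewrite Eu.
  have [g1 g2] := hg x (b x) Hx (leqnn _); rewrite ltnn in g1.
  eexists; first by apply: ExecWhileF; apply/eqP/negbFE.
  by lia.
have ub : u < b x by lia.
have [g1 g2] := hg x u Hx (ltnW ub); rewrite ub in g1.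
have [t1 e1 l1] := hc (x, u) (conj Hx ub).
have [|t2 e2 l2] := IH u.+1; first lia.
eexists; first by apply: ExecWhileT e2; [rewrite g1 | exact: e1].
rewrite /= in l1; move: l2; rewrite !mulSn; lia.
Qed.

End RunsRules.

Lemma runs_while_oracle_free (G : Type) (orc : G -> nat -> nat) (W : G -> nat)
    (H : G -> Prop) e c (b : G -> nat) (I : G -> nat -> state) :
  (forall x, 0 < W x) -> oracle_free e ->
  (forall x, H x -> b x <= W x) ->
  (forall x v, H x -> v <= b x -> forall a, Defs.mem (I x v) a <= W x) ->
  (forall x v, H x -> v <= b x ->
     (eval (fun=> 0) (Defs.mem (I x v)) e != 0) = (v < b x)) ->
  runs (fun y : G * nat => orc y.1) (fun y => W y.1)
       (fun y => H y.1 /\ y.2 < b y.1) c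
       (fun y => I y.1 y.2) (fun y => I y.1 y.2.+1) ->
  runs orc W H (While e c) (fun x => I x 0) (fun x => I x (b x)).
Proof.
move=> W0 fe bW bI gE hc; have [k _ h] := eval_poly fe.
apply: (runs_while W0 (kg := k)) hc => // x v Hx vb.
rewrite (eval_oracle_free _ (fun=> 0)) // gE //; split=> //.
by have [] := h (orc x) _ (W x) (W0 x) (bI x v Hx vb).
Qed.

Lemma runs_block (G : Type) (orc : G -> nat -> nat) (W : G -> nat)
    (H : G -> Prop) c (f g : G -> state) :
  (forall x, 0 < W x) -> straight_line c ->
  (forall x, H x -> forall a, Defs.mem (f x) a <= W x) ->
  (forall x, H x -> g x = State (run c (Defs.mem (f x))) (tapeP (f x))
                            (tapeQ (f x)) (coins (f x))) ->
  runs orc W H c f g.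
Proof.
move=> W0 sc hf hg.
apply: runs_eq (runs_straight_line orc W0
  (tapeP \o f) (tapeQ \o f) (coins \o f) sc hf) => [x _|x /hg //].
by rewrite /=; case: (f x).
Qed.

(** * The tester *)

Definition reg i := Cell (Const i).
Definition incr i e := Store (Const i) (Bin Add (reg i) e).
Definition dbl e := Bin Mul (Const 2) e.
Definition sqr e := Bin Mul e e.

(* Cells: 0 = n, 1 = k, 2 = 2 ^ k, 3 = r, 4 = N, 5 = number of samples read,
   6 = i, 7 and 8 = positive and negative part of the statistic, 9 = j,
   10 to 13 = X, Y, X', Y', 14 = V; the samples are stored from cell 15 on,
   those of P and Q alternating. *)
Definition sampleP j := Bin Add (Const 15) (Bin Mul (dbl j) (reg 0)).
Definition sampleQ j :=
  Bin Add (Const 15) (Bin Mul (Bin Add (dbl j) (Const 1)) (reg 0)).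
Definition bitP j := Cell (Bin Add (sampleP j) (reg 6)).
Definition bitQ j := Cell (Bin Add (sampleQ j) (reg 6)).

(** The loop stops at the first [k] with floor (2 ^ k * eps) nonzero, which makes cell 2 approximate
    1 / eps within a factor 2. *)
Definition scale_guard := Bin Leq (Approx (reg 1)) (Const 0).
Definition scale_body :=
  Seq (incr 1 (Const 1)) (Store (Const 2) (dbl (reg 2))).

(** The sum of two truth values is a disjunction. With E = 2 ^ k, the loop finds the least integer r
    that is at least sqrt n * E ^ 2 and n ^ (3/4) * E, without extracting roots. *)
Definition size_guard :=
  Bin Add
    (Bin Leq (Bin Add (sqr (reg 3)) (Const 1))
             (Bin Mul (reg 0) (sqr (sqr (reg 2)))))
    (Bin Leq (Bin Add (sqr (sqr (reg 3))) (Const 1))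
             (Bin Mul (Bin Mul (reg 0) (sqr (reg 0))) (sqr (sqr (reg 2))))).

Definition read_guard :=
  Bin Leq (Bin Add (reg 5) (Const 1)) (Bin Mul (Const 3) (reg 4)).
Definition read_body :=
  Seq (Sample FromP (sampleP (reg 5)))
    (Seq (Sample FromQ (sampleQ (reg 5))) (incr 5 (Const 1))).

Definition count_guard := Bin Leq (Bin Add (reg 9) (Const 1)) (reg 4).
(** Sample [j] feeds V, sample [N + j] feeds X and Y, sample [2 N + j] feeds X' and Y'. The two
    truncated differences of a pair of bits add up to their exclusive or. *)
Definition count_body :=
  let j1 := Bin Add (reg 4) (reg 9) in
  let j2 := Bin Add (dbl (reg 4)) (reg 9) in
  Seq (incr 10 (bitP j1)) (Seq (incr 11 (bitQ j1))
    (Seq (incr 12 (bitP j2)) (Seq (incr 13 (bitQ j2))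
      (Seq (incr 14 (Bin Add (Bin Defs.Sub (bitP (reg 9)) (bitQ (reg 9)))
                             (Bin Defs.Sub (bitQ (reg 9)) (bitP (reg 9)))))
           (incr 9 (Const 1)))))).

(** Natural numbers cannot hold w (X - Y) (X' - Y'), so cell 7 collects w (X X' + Y Y') and cell 8
    collects w (X Y' + Y X'). *)
Definition add_weighted :=
  let w := Bin Div (Bin Add (reg 4) (Const 1)) (Bin Add (reg 14) (Const 1)) in
  let prd i j := Bin Mul (reg i) (reg j) in
  Seq (incr 7 (Bin Mul w (Bin Add (prd 10 12) (prd 11 13))))
    (Seq (incr 8 (Bin Mul w (Bin Add (prd 10 13) (prd 11 12))))
         (incr 6 (Const 1))).

Definition clear i := Store (Const i) (Const 0).
Definition clear_counters :=
  Seq (clear 9) (Seq (clear 10) (Seq (clear 11)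
    (Seq (clear 12) (Seq (clear 13) (clear 14))))).

Definition coord_guard := Bin Leq (Bin Add (reg 6) (Const 1)) (reg 0).
Definition coord_body :=
  Seq (While count_guard count_body) (Seq add_weighted clear_counters).

(** The squared form of T <= 3 N sqrt n. Truncated subtraction replaces a negative T by 0, which is
    accepted. *)
Definition verdict :=
  Store (Const 0)
    (Bin Leq (sqr (Bin Defs.Sub (reg 7) (reg 8)))
             (Bin Mul (Const 9) (Bin Mul (sqr (reg 4)) (reg 0)))).

(** The number of repetitions is N = 160000 r; the constant stays factored to avoid a large unary
    numeral. *)
Definition tester :=
  Seq (Store (Const 2) (Const 1))
 (Seq (While scale_guard scale_body)
 (Seq (clear 3)
 (Seq (While size_guard (incr 3 (Const 1)))
 (Seq (Seq (Store (Const 4) (Bin Mul (Const 400) (Bin Mul (Const 400) (reg 3))))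
           (clear 5))
 (Seq (While read_guard read_body)
 (Seq (Seq (clear 6) (Seq (clear 7) (Seq (clear 8) clear_counters)))
 (Seq (While coord_guard coord_body)
      verdict))))))).

(** * Memory layout: registers in cells 0 to 14, sample bits above *)

Definition lay (regs : seq nat) (data : memory) : memory :=
  fun a => if a < 15 then nth 0 regs a else data (a - 15).

Lemma lay_reg regs data a : a < 15 -> lay regs data a = nth 0 regs a.
Proof. by rewrite /lay => ->. Qed.

Lemma lay_data regs data a : lay regs data (15 + a) = data a.
Proof. by rewrite /lay ltnNge leq_addr addKn. Qed.

Lemma upd_lay regs data a v : a < 15 ->
  upd (lay regs data) a v = lay (set_nth 0 regs a v) data.
Proof.
move=> lta; apply/funext => j; rewrite /upd /lay nth_set_nth /=.
by case: eqP => [->|]; rewrite ?lta.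
Qed.

Lemma lay_le regs data W :
  all (fun v => v <= W) regs -> (forall a, data a <= W) ->
  forall a, lay regs data a <= W.
Proof.
move=> /allP hr hd a; rewrite /lay; case: ifP => // _.
by case: (ltnP a (size regs)) => [/(mem_nth 0)/hr //|/(nth_default 0) ->].
Qed.

Definition bits (l : seq bool) : memory := fun a => nat_of_bool (nth false l a).

(** A sample written right behind the stored bits extends the list; cells beyond its end read 0, the
    default of [nth]. *)
Lemma upd_bits_lay regs l x :
  upd_bits (lay regs (bits l)) (15 + size l) x = lay regs (bits (l ++ x)).
Proof.
apply/funext => j; rewrite /upd_bits /lay /bits.
case: (ltnP j 15) => j15; first by rewrite ifF //; lia.
have -> : j = 15 + (j - 15) by lia.
move: (j - 15) => i; rewrite addKn -addnA leq_add2l ltn_add2l subnDl.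
rewrite nth_cat; case: (ltnP i (size l)) => //= il.
by case: ltnP => // h; rewrite !nth_default // ?leq_subRL //; lia.
Qed.

(** * Inputs of a run and the statistic on sample sequences *)

Record env := Env {
  ndim : nat;
  oracle : nat -> nat;
  nscale : nat;
  nroot : nat;
  samplesP : seq (seq bool);
  samplesQ : seq (seq bool)
}.

Definition reps (x : env) := 400 * (400 * nroot x).
Definition invE (x : env) := 2 ^ nscale x.

(** The interface between the program and the analysis over the reals: [nscale] is the first query
    with a nonzero answer, [nroot] the least number passing both size tests. *)
Definition wf (x : env) : Prop :=
  [/\ (forall k, k < nscale x -> oracle x k = 0) /\ oracle x (nscale x) = 1,
      (forall v, v < nroot x -> v ^ 2 < ndim x * invE x ^ 4 \/
                               v ^ 4 < ndim x ^ 3 * invE x ^ 4),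
      ndim x * invE x ^ 4 <= nroot x ^ 2 /\ ndim x ^ 3 * invE x ^ 4 <= nroot x
        ^ 4,
      nroot x <= ndim x * invE x ^ 2
    & [/\ size (samplesP x) = 3 * reps x, size (samplesQ x) = 3 * reps x,
          all (fun s => size s == ndim x) (samplesP x)
        & all (fun s => size s == ndim x) (samplesQ x)]].

(** Strictly above [ndim], [nscale] and [reps], because [nroot <= ndim * invE ^ 2]. The accumulators
    reach at most n (N + 1) 2 N ^ 2, which the fourth power in [cell_bound] covers. *)
Definition magnitude (x : env) := 400 * (400 * (ndim x).+1 * invE x ^ 2).
Definition cell_bound (x : env) := 4 * magnitude x ^ 4.

Definition bit (l : seq (seq bool)) (j i : nat) : nat :=
  nth false (nth [::] l j) i.
Definition ones (l : seq (seq bool)) (a N i : nat) : nat :=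
  \sum_(0 <= j < N) bit l (a + j) i.
Definition diffs (lP lQ : seq (seq bool)) (N i : nat) : nat :=
  \sum_(0 <= j < N) (bit lP j i - bit lQ j i + (bit lQ j i - bit lP j i)).

Section Statistic.
Variables (lP lQ : seq (seq bool)) (N : nat).
Definition weight i := N.+1 %/ (diffs lP lQ N i).+1.
Definition plus_term i :=
  weight i * (ones lP N N i * ones lP (2 * N) N i
              + ones lQ N N i * ones lQ (2 * N) N i).
Definition minus_term i :=
  weight i * (ones lP N N i * ones lQ (2 * N) N i
              + ones lQ N N i * ones lP (2 * N) N i).
Definition plus_part n := \sum_(0 <= i < n) plus_term i.
Definition minus_part n := \sum_(0 <= i < n) minus_term i.
Definition accepts n :=
  (plus_part n - minus_part n) ^ 2 <= 9 * (N ^ 2 * n).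
End Statistic.

Lemma bit_le1 l j i : bit l j i <= 1. Proof. exact: leq_b1. Qed.

Lemma sum_le_mul (F : nat -> nat) c n :
  (forall i, F i <= c) -> \sum_(0 <= i < n) F i <= n * c.
Proof.
move=> h; apply: (@leq_trans (\sum_(0 <= i < n) c)); first exact: leq_sum.
by rewrite sum_nat_const_nat subn0.
Qed.

Lemma ones_le l a N i : ones l a N i <= N.
Proof. by rewrite -[X in _ <= X]muln1; apply: sum_le_mul => j;
  exact: bit_le1. Qed.

Lemma diffs_le lP lQ N i : diffs lP lQ N i <= N.
Proof.
rewrite -[X in _ <= X]muln1; apply: sum_le_mul => j.
by have := bit_le1 lP j i; have := bit_le1 lQ j i; lia.
Qed.

(** The data area after reading: sample [j] of P starts at offset 2 j n, sample [j] of Q at (2 j +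
    1) n. *)
Definition interleave (lP lQ : seq (seq bool)) : seq bool :=
  flatten [seq xy.1 ++ xy.2 | xy <- zip lP lQ].

Lemma size_interleave n lP lQ : size lP = size lQ ->
  all (fun s => size s == n) lP -> all (fun s => size s == n) lQ ->
  size (interleave lP lQ) = 2 * size lP * n.
Proof.
rewrite /interleave; elim: lP lQ => [|x lP IH] [|y lQ] //= [Es].
move=> /andP[/eqP sx hP] /andP[/eqP sy hQ].
by rewrite !size_cat IH // sx sy; lia.
Qed.

Lemma nth_interleave n lP lQ j i : size lP = size lQ ->
  all (fun s => size s == n) lP -> all (fun s => size s == n) lQ ->
  i < n ->
  bits (interleave lP lQ) (2 * j * n + i) = bit lP j i /\
  bits (interleave lP lQ) ((2 * j + 1) * n + i) = bit lQ j i.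
Proof.
rewrite /bits /bit /interleave; elim: lP lQ j => [|x lP IH] [|y lQ] j //=.
  by move=> _ _ _ _; rewrite !nth_nil.
move=> [Es] /andP[/eqP sx hP] /andP[/eqP sy hQ] ni.
case: j => [|j] /=.
  rewrite muln0 mul0n mul1n !nth_cat !size_cat sx sy add0n ni ltn_addr //.
  by rewrite ltn_add2l ni ltnNge leq_addr addKn.
have [E1 E2] := IH lQ j Es hP hQ ni; rewrite -E1 -E2 !nth_cat !size_cat sx sy.
have F m : (n + n + m < n + n) = false by rewrite ltnNge leq_addr.
rewrite (_ : 2 * j.+1 * n + i = n + n + (2 * j * n + i)); last by lia.
rewrite (_ : (2 * j.+1 + 1) * n + i = n + n + ((2 * j + 1) * n + i));
  last by lia.
by rewrite !F !addKn.
Qed.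

Lemma interleave_take lP lQ v : v < size lP -> size lP = size lQ ->
  interleave (take v.+1 lP) (take v.+1 lQ) =
  interleave (take v lP) (take v lQ) ++ (nth [::] lP v ++ nth [::] lQ v).
Proof.
rewrite /interleave; elim: lP lQ v => [|x lP IH] [|y lQ] [|v] //= vs [Es].
  by rewrite !take0 /= cats0.
by rewrite IH // catA.
Qed.

Lemma cell_bound_gt0 x : 0 < cell_bound x.
Proof.
have M0 : 0 < magnitude x by rewrite /magnitude !muln_gt0 !expn_gt0.
by rewrite /cell_bound muln_gt0 expn_gt0 M0.
Qed.

Lemma wf_bounds x : wf x ->
  [/\ ndim x < magnitude x, nscale x < magnitude x, invE x <= magnitude x,
      nroot x <= magnitude x & reps x < magnitude x] /\
  4 * magnitude x <= cell_bound x.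
Proof.
move=> [_ _ _ hr _].
have E0 : 0 < invE x by rewrite expn_gt0.
have hk : nscale x < invE x by exact: ltn_expl.
have E1 : invE x <= invE x ^ 2 by rewrite expnS expn1 leq_pmulr.
have M1 : (ndim x).+1 * invE x ^ 2 <= magnitude x by rewrite /magnitude; nia.
have h1 : (ndim x).+1 <= (ndim x).+1 * invE x ^ 2
  by rewrite leq_pmulr // expn_gt0 E0.
have h2 : invE x ^ 2 <= (ndim x).+1 * invE x ^ 2 by rewrite leq_pmull.
split; last first.
  by rewrite /cell_bound leq_mul // -[X in X <= _]expn1 leq_pexp2l //; lia.
split; [lia|lia|lia| |].
  by apply: leq_trans hr _; apply: leq_trans M1; rewrite leq_mul2r leqnSn orbT.
rewrite /reps /magnitude -mulnA !ltn_pmul2l //.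
by apply: leq_ltn_trans hr _; rewrite ltn_pmul2r // expn_gt0 E0.
Qed.

Lemma bits_le x l : wf x -> forall a, bits l a <= cell_bound x.
Proof.
by move=> wx a; apply: leq_trans (leq_b1 _) (cell_bound_gt0 x).
Qed.

(** * Exact effect and running time of the loops *)

Lemma scale_runs : runs oracle cell_bound wf (While scale_guard scale_body)
  (fun x => State (lay [:: ndim x; 0; 1] (bits [::])) (samplesP x) (samplesQ x)
    [::])
  (fun x => State (lay [:: ndim x; nscale x; invE x] (bits [::]))
                  (samplesP x) (samplesQ x) [::]).
Proof.
pose I x v := State (lay [:: ndim x; v; 2 ^ v] (bits [::]))
  (samplesP x) (samplesQ x) [::].
(* The guard queries the oracle, so its cost is bounded by hand: a few bit lengths plus the query
   [v] itself, at most [7 * cell_bound x]. *)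
apply: (@runs_while env oracle cell_bound cell_bound_gt0 wf _ _ nscale I 7).
- by move=> x /wf_bounds[[]]; lia.
- move=> x v wx vk; case: (wx) => [[o0 o1] _ _ _ _].
  rewrite /= !lay_reg //=.
  have vo : oracle x v = (v == nscale x).
    by case: (ltngtP v (nscale x)) vk => // [/o0 -> //|-> _]; rewrite o1.
  rewrite vo; split; first by case: ltngtP vk.
  have := wf_bounds wx => -[[_ b1 b2 _ _] b3].
  have := leq_bitlen (nat_of_bool (v == nscale x)).
  have := leq_bitlen v; have := leq_bitlen 1; have := leq_bitlen 0.
  have := leq_bitlen ((v == nscale x) <= 0).
  have : 7 * cell_bound x <= polyb 7 (cell_bound x).
    by rewrite /polyb leq_mul // expnS leq_pmulr // expn_gt0 cell_bound_gt0.
  have : 400 <= magnitude x.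
    by rewrite /magnitude leq_pmulr // !muln_gt0 !expn_gt0.
  by case: (v == nscale x) => /=; lia.
- apply: runs_block => //.
  + by move=> y; exact: cell_bound_gt0.
  + move=> [x v] /= [wx vk]; apply: lay_le (bits_le _ wx).
    have := wf_bounds wx => -[[b0 b1 b2 _ _] b3].
    have : 2 ^ v <= invE x by rewrite leq_pexp2l // ltnW.
    by rewrite /= !andbT; lia.
  + by move=> y _; rewrite /I /= !(upd_lay, lay_reg) //= addn1 expnS.
Qed.

Lemma size_runs : runs oracle cell_bound wf (While size_guard (incr 3 (Const
  1)))
  (fun x => State (lay [:: ndim x; nscale x; invE x; 0] (bits [::]))
                  (samplesP x) (samplesQ x) [::])
  (fun x => State (lay [:: ndim x; nscale x; invE x; nroot x] (bits [::]))
                  (samplesP x) (samplesQ x) [::]).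
Proof.
pose I x v := State (lay [:: ndim x; nscale x; invE x; v] (bits [::]))
  (samplesP x) (samplesQ x) [::].
have bI x v : wf x -> v <= nroot x ->
    forall a, Defs.mem (I x v) a <= cell_bound x.
  move=> wx vk; apply: lay_le (bits_le _ wx).
  by have := wf_bounds wx => -[[b0 b1 b2 b4 _] b3]; rewrite /= !andbT; lia.
apply: (@runs_while_oracle_free env oracle cell_bound wf _ _ nroot I) => //.
- exact: cell_bound_gt0.
- by move=> x /wf_bounds[[]]; lia.
- move=> x v [_ lo [hi2 hi4] _ _] vr; rewrite /= !lay_reg //=.
  have sq a : a * a = a ^ 2 by rewrite expnS expn1.
  have qd a : a * a * (a * a) = a ^ 4 by rewrite !expnS expn0; lia.
  have cb a : a * (a * a) = a ^ 3 by rewrite !expnS expn0; lia.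
  rewrite !qd cb sq !addn1.
  case: (ltnP v (nroot x)) => [/lo|rv].
    by case=> ->; rewrite ?addn_eq0 /= ?andbF.
  have -> : v = nroot x by lia.
  by rewrite ltnNge hi2 ltnNge hi4.
- apply: runs_block => // [y|[x v] /= [wx vk]|[x v] _].
  + exact: cell_bound_gt0.
  + exact: bI (ltnW vk).
  + by rewrite /I /= !(upd_lay, lay_reg) //= addn1.
Qed.

Lemma read_runs : runs oracle cell_bound wf (While read_guard read_body)
  (fun x => State (lay [:: ndim x; nscale x; invE x; nroot x; reps x;
    0] (bits [::]))
                  (samplesP x) (samplesQ x) [::])
  (fun x => State (lay [:: ndim x; nscale x; invE x; nroot x; reps x;
    3 * reps x]
                       (bits (interleave (samplesP x) (samplesQ x))))
                  [::] [::] [::]).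
Proof.
pose J x v l := lay [:: ndim x; nscale x; invE x; nroot x; reps x; v] (bits l).
(* After [v] rounds the first [v] samples of each tape lie interleaved in memory and the others are
   still on the tapes. *)
pose I x v := State (J x v (interleave (take v (samplesP x)) (take v (samplesQ
  x))))
  (drop v (samplesP x)) (drop v (samplesQ x)) [::].
have bJ x v l : wf x -> v <= 3 * reps x ->
    forall a, J x v l a <= cell_bound x.
  move=> wx vk; apply: lay_le (bits_le _ wx).
  by have := wf_bounds wx => -[[b0 b1 b2 b4 b5] b3]; rewrite /= !andbT; lia.
apply: (@runs_eq _ _ _ _ _ (I^~ 0) (fun x => I x (3 * reps x))).
- by move=> x _; rewrite /I !take0 !drop0.
- move=> x [_ _ _ _ [sP sQ _ _]]; rewrite /I.
  by rewrite !take_oversize ?drop_oversize ?sP ?sQ.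
apply: (@runs_while_oracle_free env oracle cell_bound wf _ _ (fun x =>
  3 * reps x) I) => //.
- exact: cell_bound_gt0.
- by move=> x /wf_bounds[[]]; lia.
- by move=> x v wx vr; exact: bJ.
- by move=> x v _ vr; rewrite /= /J !lay_reg //= addn1; case: ltnP.
pose nthP (y : env * nat) := nth [::] (samplesP y.1) y.2.
pose nthQ (y : env * nat) := nth [::] (samplesQ y.1) y.2.
pose pre (y : env * nat) := interleave (take y.2 (samplesP y.1)) (take y.2
  (samplesQ y.1)).
pose H (y : env * nat) := wf y.1 /\ y.2 < 3 * reps y.1.
have W0 (y : env * nat) : 0 < cell_bound y.1 by exact: cell_bound_gt0.
have szP y : H y -> size (nthP y) = ndim y.1.
  move=> [[_ _ _ _ [sP _ /allP aP _]] vs].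
  by apply/eqP/aP/mem_nth; rewrite sP.
have szQ y : H y -> size (nthQ y) = ndim y.1.
  move=> [[_ _ _ _ [_ sQ _ /allP aQ]] vs].
  by apply/eqP/aQ/mem_nth; rewrite sQ.
have szl y : H y -> size (pre y) = 2 * y.2 * ndim y.1.
  move=> [[_ _ _ _ [sP sQ aP aQ]] vs].
  rewrite (@size_interleave (ndim y.1)) ?size_take ?sP ?sQ ?vs //.
    by move: aP; rewrite -{1}(cat_take_drop y.2 (samplesP _)) all_cat =>
      /andP[].
  by move: aQ; rewrite -{1}(cat_take_drop y.2 (samplesQ _)) all_cat => /andP[].
have dP y : H y -> drop y.2 (samplesP y.1) = nthP y :: drop y.2.+1 (samplesP
  y.1).
  by move=> [[_ _ _ _ [sP _ _ _]] vs]; rewrite -drop_nth // sP.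
have dQ y : H y -> drop y.2 (samplesQ y.1) = nthQ y :: drop y.2.+1 (samplesQ
  y.1).
  by move=> [[_ _ _ _ [_ sQ _ _]] vs]; rewrite -drop_nth // sQ.
have dimW y : H y -> ndim y.1 <= cell_bound y.1.
  by move=> [/wf_bounds[[]]]; lia.
pose f1 (y : env * nat) := State (J y.1 y.2 (pre y ++ nthP y))
   (drop y.2.+1 (samplesP y.1)) (drop y.2 (samplesQ y.1)) [::].
pose f2 (y : env * nat) := State (J y.1 y.2 ((pre y ++ nthP y) ++ nthQ y))
   (drop y.2.+1 (samplesP y.1)) (drop y.2.+1 (samplesQ y.1)) [::].
apply: (@runs_seq _ _ _ W0 _ _ _ _ f1); last apply: (@runs_seq _ _ _ W0 _ _ _ _
  f2).
- apply: runs_eq (@runs_sample _ _ _ W0 H FromP _ (fun y => J y.1 y.2 (pre y))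
    (fun y => drop y.2.+1 (samplesP y.1)) (fun y => drop y.2 (samplesQ y.1))
    (fun=> [::]) nthP _ _ _) => //.
  + by move=> y Hy /=; rewrite -dP.
  + move=> y Hy /=; rewrite /f1 /J !lay_reg //= -szl //.
    by rewrite upd_bits_lay.
  + by move=> y [wy vy]; apply: bJ => //; exact: ltnW.
  + by move=> y Hy; rewrite szP // dimW.
- apply: runs_eq (@runs_sample _ _ _ W0 H FromQ _ (fun y =>
  J y.1 y.2 (pre y ++ nthP y))
    (fun y => drop y.2.+1 (samplesP y.1)) (fun y => drop y.2.+1 (samplesQ y.1))
    (fun=> [::]) nthQ _ _ _) => //.
  + by move=> y Hy /=; rewrite /f1 dQ.
  + move=> y Hy /=; rewrite /f2 /J !lay_reg //=.
    rewrite (_ : (2 * y.2 + 1) * ndim y.1 = size (pre y ++ nthP y)).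
      by rewrite upd_bits_lay.
    by rewrite size_cat szl // szP //; lia.
  + by move=> y [wy vy]; apply: bJ => //; exact: ltnW.
  + by move=> y Hy; rewrite szQ // dimW.
- apply: runs_block => // [y [wy vy]|y [wy vy]].
  + by apply: bJ => //; exact: ltnW.
  + rewrite /I /f2 /= /J !(upd_lay, lay_reg) //= addn1.
    by case: wy => _ _ _ _ [sP sQ _ _]; rewrite interleave_take ?catA ?sP ?sQ.
Qed.

Lemma weight_le lP lQ N i : weight lP lQ N i <= N.+1.
Proof. exact: leq_div. Qed.

Lemma plus_term_le lP lQ N i : plus_term lP lQ N i <= N.+1 * (2 * N ^ 2).
Proof.
rewrite /plus_term; apply: leq_mul; first exact: weight_le.
have sq a b : a <= N -> b <= N -> a * b <= N ^ 2.
  by move=> ha hb; rewrite expnS expn1 leq_mul.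
by rewrite [X in _ <= X]mul2n -[X in _ <= X]addnn; apply: leq_add; apply: sq;
  exact: ones_le.
Qed.

Lemma minus_term_le lP lQ N i : minus_term lP lQ N i <= N.+1 * (2 * N ^ 2).
Proof.
rewrite /minus_term; apply: leq_mul; first exact: weight_le.
have sq a b : a <= N -> b <= N -> a * b <= N ^ 2.
  by move=> ha hb; rewrite expnS expn1 leq_mul.
by rewrite [X in _ <= X]mul2n -[X in _ <= X]addnn; apply: leq_add; apply: sq;
  exact: ones_le.
Qed.

Lemma plus_partS lP lQ N i :
  plus_part lP lQ N i.+1 = plus_part lP lQ N i + plus_term lP lQ N i.
Proof. by rewrite /plus_part big_nat_recr. Qed.

Lemma minus_partS lP lQ N i :
  minus_part lP lQ N i.+1 = minus_part lP lQ N i + minus_term lP lQ N i.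
Proof. by rewrite /minus_part big_nat_recr. Qed.

(** The common shape of the states of the two nested loops: [cnt] fills cells 9 to 14, the counters
    of the current coordinate. *)
Definition counter_state (x : env) (i : nat) (cnt : seq nat) :=
  let lP := samplesP x in let lQ := samplesQ x in let N := reps x in
  State (lay ([:: ndim x; nscale x; invE x; nroot x; N; 3 * N; i;
                  plus_part lP lQ N i; minus_part lP lQ N i] ++ cnt)
             (bits (interleave lP lQ))) [::] [::] [::].

Lemma counter_state_le x i cnt : wf x -> i <= ndim x ->
  all (fun v => v <= reps x) cnt ->
  forall a, Defs.mem (counter_state x i cnt) a <= cell_bound x.
Proof.
move=> wx ix hc; apply: lay_le (bits_le _ wx); rewrite all_cat.
have := wf_bounds wx => -[[b0 b1 b2 b4 b5] b3].
have cW v : v <= i * ((reps x).+1 * (2 * reps x ^ 2)) -> v <= cell_bound x.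
  move=> /leq_trans; apply; rewrite /cell_bound.
  have -> : 4 * magnitude x ^ 4 = magnitude x * (magnitude x * (4 * magnitude x
    ^ 2)).
    by rewrite !expnS expn0; lia.
  rewrite leq_mul //; first by lia.
  by rewrite leq_mul // leq_mul // leq_exp2r // ltnW.
apply/andP; split; last first.
  by apply: sub_all hc => v; lia.
have hp := cW _ (sum_le_mul i (plus_term_le (samplesP x) (samplesQ x) (reps
  x))).
have hm := cW _ (sum_le_mul i (minus_term_le (samplesP x) (samplesQ x) (reps
  x))).
have le v : v <= 4 * magnitude x -> v <= cell_bound x by move/leq_trans; exact.
by clear - hp hm le b0 b1 b2 b4 b5 ix; rewrite /= hp hm !le //; clear hp hm le;
  lia.
Qed.

Definition counters (x : env) (i v : nat) :=
  let lP := samplesP x in let lQ := samplesQ x in let N := reps x in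
  [:: v; ones lP N v i; ones lQ N v i; ones lP (2 * N) v i;
      ones lQ (2 * N) v i; diffs lP lQ v i].

(** This rule and the next two execute code symbolically one instruction at a time, while [run] is
    shielded from [simpl]. *)
Lemma run_seq c1 c2 mu : run (Seq c1 c2) mu = run c2 (run c1 mu).
Proof. by []. Qed.

Lemma run_incr i e regs data : i < 15 ->
  run (incr i e) (lay regs data) =
  lay (set_nth 0 regs i (nth 0 regs i + eval (fun=> 0) (lay regs data) e)) data.
Proof. by move=> i15; rewrite /= upd_lay // lay_reg. Qed.

Lemma run_clear i regs data : i < 15 ->
  run (clear i) (lay regs data) = lay (set_nth 0 regs i 0) data.
Proof. by move=> i15; rewrite /= upd_lay. Qed.

Section CountRuns.

Arguments run : simpl never.

(** The coordinate is part of the index [env * nat], so the time bound is uniform over coordinates,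
    as the outer loop requires. *)
Lemma count_runs :
  runs (fun y : env * nat => oracle y.1) (fun y => cell_bound y.1)
    (fun y => wf y.1 /\ y.2 < ndim y.1) (While count_guard count_body)
    (fun y => counter_state y.1 y.2 (nseq 6 0))
    (fun y => counter_state y.1 y.2 (counters y.1 y.2 (reps y.1))).
Proof.
pose I (y : env * nat) v := counter_state y.1 y.2 (counters y.1 y.2 v).
have bI (y : env * nat) v : wf y.1 /\ y.2 < ndim y.1 -> v <= reps y.1 ->
    forall a, Defs.mem (I y v) a <= cell_bound y.1.
  move=> [wy iy] vr; apply: counter_state_le => //; first exact: ltnW.
  by rewrite /= vr !(leq_trans (ones_le _ _ _ _)) // (leq_trans (diffs_le _ _ _
    _)).
have W0 (y : env * nat) : 0 < cell_bound y.1 by exact: cell_bound_gt0.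
apply: (@runs_eq _ _ _ _ _ (I^~ 0) (fun y => I y (reps y.1))) => //.
  by move=> y _; rewrite /I /counters /ones /diffs !big_geq.
apply: (@runs_while_oracle_free _ _ _ _ _ _ (fun y => reps y.1) I) => //.
- by move=> y [/wf_bounds[[]]]; lia.
- by move=> x v _ vr; rewrite /= !lay_reg //= addn1; case: ltnP.
apply: runs_block => // [y [Hy vy]|[[x i] v] [[wx ix] vx]].
- by apply: bI => //; exact: ltnW.
- case: (wx) => _ _ _ _ [sP sQ aP aQ].
  have rdP j := proj1 (nth_interleave j (etrans sP (esym sQ)) aP aQ ix).
  have rdQ j := proj2 (nth_interleave j (etrans sP (esym sQ)) aP aQ ix).
  rewrite /= in rdP rdQ.
  rewrite /I /counter_state /counters /= /count_body.
  move: rdP rdQ {wx vx sP sQ aP aQ bI I};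
    move: (samplesP x) (samplesQ x) => lP lQ.
  move: (reps x) => N rdP rdQ.
  have layE regs data : (lay regs data 0 = nth 0 regs 0) *
    (lay regs data 4 = nth 0 regs 4) * (lay regs data 6 = nth 0 regs 6) *
    (lay regs data 9 = nth 0 regs 9) by [].
  have layD regs data a b : lay regs data (15 + a + b) = data (a + b).
    by rewrite -addnA lay_data.
  rewrite run_seq (run_incr _ _ _ (isT : 10 < 15)) /= !layE /= layD rdP.
  rewrite run_seq (run_incr _ _ _ (isT : 11 < 15)) /= !layE /= layD rdQ.
  rewrite run_seq (run_incr _ _ _ (isT : 12 < 15)) /= !layE /= layD rdP.
  rewrite run_seq (run_incr _ _ _ (isT : 13 < 15)) /= !layE /= layD rdQ.
  rewrite run_seq (run_incr _ _ _ (isT : 14 < 15)) /= !layE /= !layD rdP rdQ.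
  rewrite (run_incr _ _ _ (isT : 9 < 15)) /=.
  by rewrite /counters /ones /diffs !big_nat_recr //= addn1.
Qed.

Lemma coord_runs : runs oracle cell_bound wf (While coord_guard coord_body)
  (fun x => counter_state x 0 (nseq 6 0))
  (fun x => counter_state x (ndim x) (nseq 6 0)).
Proof.
pose I x i := counter_state x i (nseq 6 0).
apply: (@runs_while_oracle_free _ _ _ _ _ _ ndim I) => //.
- exact: cell_bound_gt0.
- by move=> x /wf_bounds[[]]; lia.
- by move=> x i wx ix; exact: counter_state_le.
- by move=> x v _ vr; rewrite /= !lay_reg //= addn1; case: ltnP.
have W0 (y : env * nat) : 0 < cell_bound y.1 by exact: cell_bound_gt0.
apply: runs_seq => //; first exact: count_runs.
apply: runs_block => // [y [wy iy]|[x i] /= [wx ix]].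
- apply: counter_state_le => //; first exact: ltnW.
  by rewrite /= leqnn !ones_le diffs_le.
- rewrite /I /counter_state /counters /nseq /ncons /iter {I}.
  rewrite plus_partS minus_partS /plus_term /minus_term /weight.
  move: (plus_part _ _ _ _) (minus_part _ _ _ _) => A B.
  move: (reps x) => N.
  move: (diffs _ _ _ _) (ones _ _ _ _) (ones _ _ _ _) (ones _ _ _ _) (ones _ _
    _ _).
  move=> D X1 X2 X3 X4 {wx ix W0}; congr State.
  rewrite /= /add_weighted /clear_counters.
  have layE regs data : (lay regs data 4 = nth 0 regs 4) *
    (lay regs data 10 = nth 0 regs 10) * (lay regs data 11 = nth 0 regs 11) *
    (lay regs data 12 = nth 0 regs 12) * (lay regs data 13 = nth 0 regs 13) *
    (lay regs data 14 = nth 0 regs 14) by [].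
  rewrite !run_seq (run_incr _ _ _ (isT : 7 < 15)) /= !layE /=.
  rewrite (run_incr _ _ _ (isT : 8 < 15)) /= !layE /=.
  rewrite (run_incr _ _ _ (isT : 6 < 15)) /=.
  by rewrite !run_clear // /= !addn1.
Qed.

End CountRuns.

(** The loops alternate with straight-line blocks whose final memories compute to the initial
    layouts of the next loop. *)
Lemma tester_runs : exists k, forall x, wf x ->
  exists t s, [/\ exec (oracle x) tester
                    (State (upd (fun=> 0) 0 (ndim x)) (samplesP x) (samplesQ x)
                      [::])
                    t s, t <= polyb k (cell_bound x)
    & (Defs.mem s 0 != 0) = accepts (samplesP x) (samplesQ x) (reps x) (ndim
      x)].
Proof.
have E0 n : upd (fun=> 0) 0 n = lay [:: n] (bits [::]).
  apply/funext => a; rewrite /upd /lay /bits nth_nil; case: a => [|a] //=.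
  by rewrite nth_nil if_same.
have W0 := cell_bound_gt0.
pose f0 x := State (upd (fun=> 0) 0 (ndim x)) (samplesP x) (samplesQ x) [::].
pose f1 x := counter_state x (ndim x) (nseq 6 0).
have [k h] : runs oracle cell_bound wf tester f0
    (fun x => State (run verdict (Defs.mem (f1 x))) [::] [::] [::]).
  apply: (runs_seq W0 _ (runs_seq W0 scale_runs (runs_seq W0 _
    (runs_seq W0 size_runs (runs_seq W0 _ (runs_seq W0 read_runs
      (runs_seq W0 _ (runs_seq W0 coord_runs _)))))))).
  - apply: runs_block => // [x wx|x wx].
      rewrite /f0 E0; apply: lay_le (bits_le _ wx).
      by have := wf_bounds wx => -[[b0 b1 b2 b4 b5] b3]; rewrite /= !andbT; lia.
    by rewrite /f0 E0 /= upd_lay.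
  - apply: runs_block => // [x wx|x wx]; last by rewrite /= upd_lay.
    apply: lay_le (bits_le _ wx).
    by have := wf_bounds wx => -[[b0 b1 b2 b4 b5] b3]; rewrite /= !andbT; lia.
  - apply: runs_block => // [x wx|x wx]; last by rewrite /= !(upd_lay, lay_reg).
    apply: lay_le (bits_le _ wx).
    by have := wf_bounds wx => -[[b0 b1 b2 b4 b5] b3]; rewrite /= !andbT; lia.
  - apply: runs_block => // [x wx|x wx].
      apply: lay_le (bits_le _ wx).
      by have := wf_bounds wx => -[[b0 b1 b2 b4 b5] b3]; rewrite /= !andbT; lia.
    rewrite /clear_counters /= !(upd_lay, lay_reg) //= /counter_state /=.
    by rewrite /plus_part /minus_part !big_geq.
  - by apply: runs_block => // x wx; exact: counter_state_le.
exists k => x wx; have [t et lt] := h x wx; exists t; eexists; split=> //.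
  exact: et.
rewrite /= !(upd_lay, lay_reg) //= /accepts !expnS !expn0 !muln1.
by case: (_ <= _).
Qed.

Local Open Scope ring_scope.

(** * Expectations over independent samples *)

Section TupleSums.
Variables (R : comNzRingType) (T : finType).

Lemma sum_tuple0 (F : 0.-tuple T -> R) : \sum_t F t = F [tuple].
Proof. by rewrite (big_pred1 [tuple]) // => t; rewrite (tuple0 t) /= eqxx. Qed.

Lemma sum_tupleS k (F : k.+1.-tuple T -> R) :
  \sum_t F t = \sum_x \sum_(t : k.-tuple T) F [tuple of x :: t].
Proof.
rewrite pair_big /=.
rewrite (reindex (fun xt : T * k.-tuple T => [tuple of xt.1 :: xt.2])) //=.
exists (fun t : k.+1.-tuple T => (thead t, [tuple of behead t])) =>
  [[x t] _|t _] /=.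
  by congr pair; apply/val_inj.
by rewrite -tuple_eta.
Qed.

Lemma sum_prod_tuple k (F : 'I_k -> T -> R) :
  \sum_(t : k.-tuple T) \prod_(i < k) F i (tnth t i) =
  \prod_(i < k) \sum_x F i x.
Proof.
elim: k F => [|k IH] F; first by rewrite sum_tuple0 !big_ord0.
rewrite sum_tupleS big_ord_recl mulr_suml; apply: eq_bigr => x _.
rewrite -IH mulr_sumr; apply: eq_bigr => t _.
rewrite big_ord_recl tnth0; congr (_ * _).
by apply: eq_bigr => i _; rewrite tnthS.
Qed.

End TupleSums.

Section Rounds.
Variables (R : realType) (T : finType) (P Q : T -> R).
Hypotheses (P_ge0 : forall x, 0 <= P x) (Q_ge0 : forall x, 0 <= Q x).
Hypotheses (P_sum1 : \sum_x P x = 1) (Q_sum1 : \sum_x Q x = 1).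

Definition expect1 (g : T -> T -> R) : R := \sum_x \sum_y P x * Q y * g x y.

(** Expectation over [m] independent pairs drawn from P and Q. The recursion on rounds lets moments
    be computed by induction on [m]. *)
Fixpoint expect (m : nat) (g : seq T -> seq T -> R) : R :=
  if m is m'.+1 then
    expect1 (fun x y => expect m' (fun s t => g (x :: s) (y :: t)))
  else g [::] [::].

Lemma expect1D g h :
  expect1 (fun x y => g x y + h x y) = expect1 g + expect1 h.
Proof.
rewrite /expect1 -big_split; apply: eq_bigr => x _; rewrite -big_split.
by apply: eq_bigr => y _; rewrite mulrDr.
Qed.

Lemma expect1Z c g : expect1 (fun x y => c * g x y) = c * expect1 g.
Proof.
rewrite /expect1 mulr_sumr; apply: eq_bigr => x _; rewrite mulr_sumr.
by apply: eq_bigr => y _; rewrite mulrCA.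
Qed.

Lemma eq_expect1 g h : (forall x y, g x y = h x y) -> expect1 g = expect1 h.
Proof. by move=> E; apply: eq_bigr => x _; apply: eq_bigr => y _;
  rewrite E. Qed.

Lemma ler_expect1 g h :
  (forall x y, g x y <= h x y) -> expect1 g <= expect1 h.
Proof.
move=> le; apply: ler_sum => x _; apply: ler_sum => y _.
by apply: ler_wpM2l (le x y); exact: mulr_ge0.
Qed.

Lemma expect1_mul (f g : T -> R) :
  expect1 (fun x y => f x * g y) = (\sum_x P x * f x) * (\sum_y Q y * g y).
Proof.
rewrite /expect1 mulr_suml; apply: eq_bigr => x _; rewrite mulr_sumr.
by apply: eq_bigr => y _; ring.
Qed.

Lemma expect1_cst c : expect1 (fun _ _ => c) = c.
Proof.
have := expect1_mul (fun=> c) (fun=> 1); under eq_expect1 do rewrite mulr1.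
by move=> ->; rewrite -mulr_suml P_sum1 -mulr_suml Q_sum1 !mul1r mulr1.
Qed.

Lemma eq_expect m g h :
  (forall s t, size s = m -> size t = m -> g s t = h s t) ->
  expect m g = expect m h.
Proof.
elim: m g h => [|m IH] g h E /=; first exact: E.
apply: eq_expect1 => x y; apply: IH => s t ss st.
by apply: E => /=; rewrite ?ss ?st.
Qed.

Lemma ler_expect m g h :
  (forall s t, size s = m -> size t = m -> g s t <= h s t) ->
  expect m g <= expect m h.
Proof.
elim: m g h => [|m IH] g h E /=; first exact: E.
apply: ler_expect1 => x y; apply: IH => s t ss st.
by apply: E => /=; rewrite ?ss ?st.
Qed.

Lemma expectD m g h :
  expect m (fun s t => g s t + h s t) = expect m g + expect m h.
Proof.
elim: m g h => //= m IH g h; rewrite -expect1D.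
by apply: eq_expect1 => x y; rewrite IH.
Qed.

Lemma expectZ m c g : expect m (fun s t => c * g s t) = c * expect m g.
Proof.
elim: m g => //= m IH g; rewrite -expect1Z.
by apply: eq_expect1 => x y; rewrite IH.
Qed.

Lemma expect_cst m c : expect m (fun _ _ => c) = c.
Proof.
elim: m => //= m IH; rewrite -[RHS]expect1_cst.
by apply: eq_expect1 => x y; rewrite IH.
Qed.

Lemma expect_sum m (I : finType) (g : I -> seq T -> seq T -> R) :
  expect m (fun s t => \sum_i g i s t) = \sum_i expect m (g i).
Proof.
elim: (index_enum I) => [|i r IH].
  by rewrite big_nil -[RHS](expect_cst m); apply: eq_expect => *;
    rewrite big_nil.
rewrite big_cons -IH -expectD; apply: eq_expect => *.
by rewrite big_cons.
Qed.

(** Independence of consecutive blocks; it allows conditioning on the block that fixes the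
    weights. *)
Lemma expect_cat a b g :
  expect (a + b) g =
  expect a (fun s t => expect b (fun s' t' => g (s ++ s') (t ++ t'))).
Proof.
elim: a g => //= a IH g.
by apply: eq_expect1 => x y; rewrite IH.
Qed.

(** Connects the recursive expectation with the product weights of sample tapes. *)
Lemma expect_tuples m g :
  expect m g = \sum_(s : m.-tuple T) \sum_(t : m.-tuple T)
    (\prod_(i < m) P (tnth s i)) * (\prod_(i < m) Q (tnth t i)) * g s t.
Proof.
elim: m g => [|m IH] g; first by rewrite /= !sum_tuple0 !big_ord0 !mul1r.
rewrite /= /expect1 sum_tupleS; apply: eq_bigr => x _.
under [RHS]eq_bigr => s _ do rewrite sum_tupleS.
rewrite exchange_big; apply: eq_bigr => y _; rewrite IH mulr_sumr.
apply: eq_bigr => s _; rewrite mulr_sumr; apply: eq_bigr => t _.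
rewrite !big_ord_recl !tnth0.
under [in RHS]eq_bigr do rewrite tnthS.
under [X in _ = _ * (_ * X) * _]eq_bigr do rewrite tnthS.
by ring.
Qed.

End Rounds.

(** * Moments of the binomial distribution *)

Section Binomial.
Variables (R : realFieldType) (b : R).
Hypothesis b01 : 0 <= b <= 1.

(* The expectation of [h V] for [V] binomial with parameters [m] and [b]. *)
Fixpoint binexp (m : nat) (h : nat -> R) : R :=
  if m is m'.+1 then
    b * binexp m' (fun k => h k.+1) + (1 - b) * binexp m' h
  else h 0%N.

Lemma binexpS m h :
  binexp m.+1 h = b * binexp m (fun k => h k.+1) + (1 - b) * binexp m h.
Proof. by []. Qed.

Lemma eq_binexp m h h' : (forall k, h k = h' k) -> binexp m h = binexp m h'.
Proof.
by elim: m h h' => //= m IH h h' E; rewrite (IH _ _ E) (IH _ (h' \o succn)) /=.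
Qed.

Lemma ler_binexp m h h' : (forall k, h k <= h' k) -> binexp m h <= binexp m h'.
Proof.
case/andP: b01 => b0 b1; elim: m h h' => //= m IH h h' le.
by apply: lerD; apply: ler_wpM2l; rewrite ?subr_ge0 //; apply: IH.
Qed.

Lemma binexpD m h h' : binexp m (fun k => h k + h' k) = binexp m h + binexp m
  h'.
Proof. by elim: m h h' => //= m IH h h'; rewrite !IH; ring. Qed.

Lemma binexp_cst m c : binexp m (fun=> c) = c.
Proof. by elim: m => //= m ->; ring. Qed.

(** The absorption identity k C(m + 1, k) = (m + 1) C(m, k - 1) in terms of expectations. *)
Lemma binexp_succ m h :
  m.+1%:R * b * binexp m (fun k => h k.+1) = binexp m.+1 (fun k => k%:R * h k).
Proof.
elim: m h => [|m IH] h; first by rewrite /=; ring.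
rewrite [RHS]binexpS.
have -> : binexp m.+1 (fun k => k.+1%:R * h k.+1) =
    binexp m.+1 (fun k => h k.+1) + binexp m.+1 (fun k => k%:R * h k.+1).
  by rewrite -binexpD; apply: eq_binexp => k; rewrite -natr1; ring.
rewrite -[X in _ = b * (_ + X) + _](IH (fun k => h k.+1)).
rewrite -[X in _ = _ + (1 - b) * X](IH h) /= -!natr1.
by ring.
Qed.

Lemma binexp_id m : binexp m (fun k => k%:R) = m%:R * b.
Proof.
case: m => [|m]; first by rewrite mul0r.
have := binexp_succ m (fun=> 1); rewrite binexp_cst mulr1 => ->.
by apply: eq_binexp => k; rewrite mulr1.
Qed.

(** From 1 / (k + 1) ^ 2 <= 2 / ((k + 1) (k + 2)), absorption applied twice turns b ^ 2 (m + 1) (m +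
    2) E[1 / ((V + 1) (V + 2))] into a probability for m + 2 trials, hence at most 1. *)
Lemma binexp_inv2_le m :
  b ^+ 2 * binexp m (fun k => (m.+1%:R / k.+1%:R) ^+ 2) <= 2.
Proof.
case/andP: (b01) => b0 b1.
have S0 k : 0 < k.+1%:R :> R by rewrite ltr0n.
have Ud k : k.+1%:R != 0 :> R by rewrite pnatr_eq0.
(* Since the inverse of 0 is 0, the terms at [k = 0] vanish; the two bounds below are therefore
   inequalities. *)
pose h k : R := (k%:R * k.+1%:R)^-1.
have le1 : binexp m.+1 (fun k => k%:R * h k) <= binexp m.+1 (fun k =>
  k.+1%:R^-1).
  apply: ler_binexp => -[|k]; first by rewrite mul0r invr_ge0 ler0n.
  by rewrite /h invfM mulrA mulfV // mul1r.
have le2 : binexp m.+2 (fun k => k%:R * k%:R^-1) <= 1.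
  rewrite -[X in _ <= X](binexp_cst m.+2); apply: ler_binexp => -[|k].
    by rewrite mul0r ler01.
  by rewrite mulfV.
rewrite -(binexp_succ m.+1 (fun k => k%:R^-1)) in le2.
rewrite -binexp_succ in le1.
have scale c g : binexp m (fun k => c * g k) = c * binexp m g.
  by elim: m g {le1 le2} => //= m' IH g; rewrite !IH; ring.
have step : binexp m (fun k => (m.+1%:R / k.+1%:R) ^+ 2) <=
    2 * (m.+1%:R * m.+2%:R) * binexp m (fun k => h k.+1).
  rewrite -scale; apply: ler_binexp => k.
  rewrite /h expr_div_n ler_pdivrMr ?exprn_gt0 //.
  have -> : 2 * (m.+1%:R * m.+2%:R) * (k.+1%:R * k.+2%:R)^-1 * k.+1%:R ^+ 2
      = m.+1%:R * (2 * m.+2%:R * k.+1%:R / k.+2%:R) :> R.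
    move: (Ud k) (Ud k.+1); move: (k.+1%:R : R) (k.+2%:R : R) => u v u0 v0.
    by field; rewrite v0 u0.
  rewrite expr2 ler_pM2l // ler_pdivlMr // -!natrM ler_nat.
  nia.
apply: le_trans (ler_wpM2l (sqr_ge0 b) step) _.
move: le1 le2; set x := binexp m _; set y := binexp m.+1 _ => le1 le2.
have le3 : m.+2%:R * b * (m.+1%:R * b * x) <= m.+2%:R * b * y.
  by apply: ler_wpM2l => //; rewrite mulr_ge0 ?ler0n.
by nra.
Qed.

End Binomial.

(** * Coordinate means of a product distribution *)

Section Marginals.
Variables (R : realType) (n : nat) (P : {ffun n.-tuple bool -> R}).
Hypothesis prodP : product_dist P.

Definition mean (i : 'I_n) : R := marginal P i true.

Lemma marginal_ge0 i b : 0 <= marginal P i b.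
Proof. by case: prodP => [[P0 _] _]; apply: sumr_ge0. Qed.

Lemma marginal_sum1 i : \sum_b marginal P i b = 1.
Proof.
case: prodP => [[_ <-] _]; rewrite /marginal.
by rewrite [RHS](partition_big (fun x => tnth x i) predT).
Qed.

Lemma marginal_false i : marginal P i false = 1 - mean i.
Proof. by rewrite -(marginal_sum1 i) big_bool /= /mean; ring. Qed.

Lemma mean01 i : 0 <= mean i <= 1.
Proof.
rewrite marginal_ge0 /=; have := marginal_ge0 i false.
by rewrite marginal_false subr_ge0.
Qed.

Lemma expect_coords (f : 'I_n -> bool -> R) :
  \sum_x P x * \prod_i f i (tnth x i) =
  \prod_i (mean i * f i true + (1 - mean i) * f i false).
Proof.
case: prodP => _ PE.
transitivity (\sum_x \prod_i (marginal P i (tnth x i) * f i (tnth x i))).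
  by apply: eq_bigr => x _; rewrite PE big_split.
rewrite (sum_prod_tuple (fun i b => marginal P i b * f i b)).
by apply: eq_bigr => i _; rewrite big_bool /= marginal_false.
Qed.

Lemma expect_bit i : \sum_x P x * (tnth x i)%:R = mean i.
Proof.
rewrite /mean /marginal [RHS]big_mkcond; apply: eq_bigr => x _.
by case: (tnth x i); rewrite ?mulr1 ?mulr0.
Qed.

Lemma expect_bit2 i l : i != l ->
  \sum_x P x * ((tnth x i)%:R * (tnth x l)%:R) = mean i * mean l.
Proof.
move=> il.
(* The neutral factor 1 off the coordinates [i] and [l] makes the product of two bits a product over
   all coordinates. *)
pose f k (b : bool) : R := if (k == i) || (k == l) then b%:R else 1.
transitivity (\sum_x P x * \prod_k f k (tnth x k)).
  apply: eq_bigr => x _; congr (_ * _).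
  rewrite (bigD1 i) //= (bigD1 l) /=; last by rewrite eq_sym.
  rewrite big1 => [|k /andP[/negPf ki /negPf kl]]; last by rewrite /f ki kl.
  by rewrite /f !eqxx orbT mulr1.
rewrite expect_coords (bigD1 i) //= (bigD1 l) /=; last by rewrite eq_sym.
rewrite big1 => [|k /andP[/negPf ki /negPf kl]]; last first.
  by rewrite /f ki kl /=; ring.
by rewrite /f !eqxx orbT /=; ring.
Qed.

End Marginals.

(** * First and second moments of one block of samples *)

Section Moments.
Variables (R : realType) (n : nat) (P Q : {ffun n.-tuple bool -> R}).
Hypotheses (prodP : product_dist P) (prodQ : product_dist Q).
Local Notation T := (n.-tuple bool).

Definition gap i : R := mean P i - mean Q i.
Definition disagree i : R := mean P i + mean Q i - 2 * mean P i * mean Q i.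
(** The variance of a bit of P minus a bit of Q: the square of this difference indicates
    disagreement. *)
Definition var i : R := disagree i - gap i ^+ 2.

Lemma disagree01 i : 0 <= disagree i <= 1.
Proof.
have /andP[p0 p1] := mean01 prodP i; have /andP[q0 q1] := mean01 prodQ i.
by rewrite /disagree; nra.
Qed.

Lemma var_ge0 i : 0 <= var i.
Proof.
have /andP[p0 p1] := mean01 prodP i; have /andP[q0 q1] := mean01 prodQ i.
by rewrite /var /disagree /gap; nra.
Qed.

Lemma var_le i : var i <= disagree i.
Proof. by rewrite lerBlDr lerDl sqr_ge0. Qed.

Local Notation E1 := (@expect1 R T P Q).
Local Notation E := (@expect R T P Q).

Let P1 : \sum_x P x = 1. Proof. by case: prodP => -[]. Qed.
Let Q1 : \sum_x Q x = 1. Proof. by case: prodQ => -[]. Qed.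

Let Pc : \sum_x P x * 1 = 1. Proof. by rewrite -mulr_suml P1 mulr1. Qed.
Let Qc : \sum_x Q x * 1 = 1. Proof. by rewrite -mulr_suml Q1 mulr1. Qed.

Definition bitdiff (i : 'I_n) (x y : T) : R := (tnth x i)%:R - (tnth y i)%:R.

Lemma expect1_bitdiff i : E1 (bitdiff i) = gap i.
Proof.
rewrite (@eq_expect1 _ _ _ _ _ (fun x y : T =>
  (tnth x i)%:R * 1 + (-1) * (1 * (tnth y i)%:R))).
  rewrite expect1D expect1Z !expect1_mul !expect_bit //.
  rewrite ?Pc ?Qc /gap; ring.
by move=> x y; rewrite /bitdiff; ring.
Qed.

Lemma expect1_neq i (h0 h1 : R) :
  E1 (fun x y : T => if tnth x i != tnth y i then h1 else h0) =
  disagree i * h1 + (1 - disagree i) * h0.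
Proof.
pose X (x : T) : R := (tnth x i)%:R.
(* For bits, x != y has the indicator x + y - 2 x y, so a function of the disagreement is affine in
   it. *)
rewrite (@eq_expect1 _ _ _ _ _
  (fun x y : T => h0 + (h1 - h0) * ((-2) * (X x * X y) + (X x * 1 + 1 * X y)))).
  rewrite expect1D expect1_cst // expect1Z !expect1D.
  rewrite (expect1Z P Q (-2) (fun x y => X x * X y)) !expect1_mul.
  rewrite !expect_bit // ?Pc ?Qc /disagree; ring.
by move=> x y; rewrite /X; case: (tnth x i) (tnth y i) => -[] /=; ring.
Qed.

(** Distinct coordinates are independent, so only the diagonal carries a variance. *)
Lemma expect1_bitdiff2 i l :
  E1 (fun x y : T => bitdiff i x y * bitdiff l x y) =
  gap i * gap l + (i == l)%:R * var i.
Proof.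
case: (altP (i =P l)) => [<-|il].
  rewrite (@eq_expect1 _ _ _ _ _ (fun x y : T =>
    if tnth x i != tnth y i then 1 else 0)).
    by rewrite expect1_neq /var mul1r; ring.
  by move=> x y; rewrite /bitdiff; case: (tnth x i) (tnth y i) => -[] /=; ring.
pose X i (x : T) : R := (tnth x i)%:R.
rewrite (@eq_expect1 _ _ _ _ _
  (fun x y : T => X i x * X l x * 1 + ((-1) * (X i x * X l y) +
    ((-1) * (X l x * X i y) + 1 * (X i y * X l y))))).
  rewrite !expect1D (expect1Z P Q (-1) (fun x y => X i x * X l y)).
  rewrite (expect1Z P Q (-1) (fun x y => X l x * X i y)) !expect1_mul.
  rewrite !expect_bit // !expect_bit2 // ?Pc ?Qc mul0r addr0 /gap; ring.
by move=> x y; rewrite /bitdiff /X; ring.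
Qed.

Definition countdiff (i : 'I_n) (s t : seq T) : R :=
  \sum_(x <- s) (tnth x i)%:R - \sum_(y <- t) (tnth y i)%:R.

Lemma countdiff_cons i x y s t :
  countdiff i (x :: s) (y :: t) = bitdiff i x y + countdiff i s t.
Proof. by rewrite /countdiff !big_cons /bitdiff; ring. Qed.

Lemma expect_countdiff m i : E m (countdiff i) = m%:R * gap i.
Proof.
elim: m => [|m IH]; first by rewrite /= /countdiff !big_nil subrr mul0r.
rewrite /= (@eq_expect1 _ _ _ _ _ (fun x y : T =>
  bitdiff i x y + m%:R * gap i)).
  by rewrite expect1D expect1_bitdiff expect1_cst // -natr1; ring.
move=> x y; rewrite -IH -[X in X + _](expect_cst P1 Q1 m) -expectD.
by apply: eq_expect => s t _ _; rewrite countdiff_cons.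
Qed.

(** Means and covariances both add over independent rounds: the product of the means grows like m ^
    2, the covariance like m. *)
Lemma expect_countdiff2 m i l :
  E m (fun s t => countdiff i s t * countdiff l s t) =
  m%:R ^+ 2 * (gap i * gap l) + (i == l)%:R * (m%:R * var i).
Proof.
elim: m => [|m IH]; first by rewrite /= /countdiff !big_nil; ring.
move: IH; set v := (_ + _ in RHS) => IH; have Ev := erefl v;
  rewrite {2}/v in Ev.
move: v Ev IH => v Ev IH.
rewrite /= (@eq_expect1 _ _ _ _ _ (fun x y : T =>
   bitdiff i x y * bitdiff l x y + (m%:R * gap l * bitdiff i x y +
   (m%:R * gap i * bitdiff l x y + v)))).
  rewrite !expect1D expect1_bitdiff2 expect1_cst // !expect1Z !expect1_bitdiff.
  by rewrite Ev -natr1; ring.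
move=> x y.
rewrite (@eq_expect _ _ _ _ _ _ (fun s t =>
  bitdiff i x y * bitdiff l x y + (bitdiff i x y * countdiff l s t +
  (bitdiff l x y * countdiff i s t + countdiff i s t * countdiff l s t)))).
  by rewrite !expectD IH !expectZ !expect_countdiff expect_cst //; ring.
by move=> s t _ _; rewrite !countdiff_cons; ring.
Qed.

Definition ndiff (i : 'I_n) (s t : seq T) : nat :=
  (\sum_(xy <- zip s t) (tnth xy.1 i != tnth xy.2 i))%N.

(** Each round disagrees at [i] independently with probability [disagree i], so the count is
    binomial. *)
Lemma expect_ndiff m i h :
  E m (fun s t => h (ndiff i s t)) = binexp (disagree i) m h.
Proof.
elim: m h => [|m IH] h; first by rewrite /= /ndiff big_nil.
rewrite /= -expect1_neq; apply: eq_expect1 => x y.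
rewrite -!IH; case: ifP => xy; apply: eq_expect => s t _ _.
  by rewrite /ndiff /= big_cons /= xy.
by rewrite /ndiff /= big_cons /= xy.
Qed.

Lemma ndiff_le m i s t : size s = m -> size t = m -> (ndiff i s t <= m)%N.
Proof.
move=> ss st; apply: (@leq_trans (\sum_(xy <- zip s t) 1)%N).
  by apply: leq_sum => xy _; exact: leq_b1.
by rewrite sum1_size size_zip ss st minnn.
Qed.

End Moments.

(** * Tail bounds for the statistic *)

Section Tails.
Variables (R : realType) (n : nat) (P Q : {ffun n.-tuple bool -> R}).
Hypotheses (prodP : product_dist P) (prodQ : product_dist Q).
Variable N : nat.
Hypotheses (n_gt0 : (0 < n)%N) (N_gt0 : (0 < N)%N).
Local Notation T := (n.-tuple bool).
Local Notation E := (@expect R T P Q N).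
Local Notation gap := (gap P Q).
Local Notation var := (var P Q).
Local Notation disagree := (disagree P Q).
Local Notation Nr := (N%:R : R).

Let P1 : \sum_x P x = 1. Proof. by case: prodP => -[]. Qed.
Let Q1 : \sum_x Q x = 1. Proof. by case: prodQ => -[]. Qed.
Let P0 x : 0 <= P x. Proof. by case: prodP => -[]. Qed.
Let Q0 x : 0 <= Q x. Proof. by case: prodQ => -[]. Qed.
Let N0 : 0 < Nr. Proof. by rewrite ltr0n. Qed.

(** Expectation over the second and third block, taken with the weights of the first block held
    fixed. *)
Definition expect2 (F : seq T -> seq T -> seq T -> seq T -> R) : R :=
  E (fun s t => E (F s t)).

Lemma ler_expect2 F G : (forall s t s' t', F s t s' t' <= G s t s' t') ->
  expect2 F <= expect2 G.
Proof.
by move=> le; apply: ler_expect => // s t _ _;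
  apply: ler_expect => // s' t' _ _.
Qed.

Lemma expect2_cst c : expect2 (fun _ _ _ _ => c) = c.
Proof.
rewrite /expect2 -[RHS](expect_cst P1 Q1 N); apply: eq_expect => s t _ _.
by rewrite expect_cst.
Qed.

Lemma expect2D F G :
  expect2 (fun s t s' t' => F s t s' t' + G s t s' t') = expect2 F + expect2 G.
Proof.
by rewrite /expect2 -expectD; apply: eq_expect => s t _ _; rewrite expectD.
Qed.

Lemma expect2Z c F :
  expect2 (fun s t s' t' => c * F s t s' t') = c * expect2 F.
Proof.
by rewrite /expect2 -expectZ; apply: eq_expect => s t _ _; rewrite expectZ.
Qed.

Lemma expect2_sum (I : finType) F :
  expect2 (fun s t s' t' => \sum_(i : I) F i s t s' t') = \sum_i expect2 (F i).
Proof.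
rewrite /expect2 -expect_sum //; apply: eq_expect => s t _ _.
by rewrite expect_sum.
Qed.

Lemma expect2_mul f g :
  expect2 (fun s t s' t' => f s t * g s' t') = E f * E g.
Proof.
rewrite /expect2 mulrC -expectZ; apply: eq_expect => s t _ _.
by rewrite expectZ mulrC.
Qed.

Lemma eq_expect2 F G : (forall s t s' t', F s t s' t' = G s t s' t') ->
  expect2 F = expect2 G.
Proof.
by move=> EFG; apply: eq_expect => s t _ _; apply: eq_expect => s' t' _ _.
Qed.

Section FixedWeights.
Variable w : 'I_n -> R.

Definition stat s t s' t' : R :=
  \sum_i w i * (countdiff R i s t * countdiff R i s' t').

Definition stat_mean : R := Nr ^+ 2 * \sum_i w i * gap i ^+ 2.

Definition noise : R := \sum_i (w i * (Nr * var i)) ^+ 2.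

Lemma expect2_stat : expect2 stat = stat_mean.
Proof.
rewrite expect2_sum /stat_mean mulr_sumr; apply: eq_bigr => i _.
by rewrite expect2Z expect2_mul !expect_countdiff //; ring.
Qed.

(** Expanding the square gives a double sum over [i] and [l]; independence of the two blocks makes
    each expectation a product of two mixed moments. Off the diagonal these match the square of the
    mean, so only [i = l] contributes. *)
Lemma stat_variance :
  expect2 (fun s t s' t' => (stat s t s' t' - stat_mean) ^+ 2) =
  \sum_i 2 * (Nr ^+ 2 * (w i * gap i ^+ 2)) * (w i * (Nr * var i)) + noise.
Proof.
rewrite (@eq_expect2 _ (fun s t s' t' =>
  \sum_i \sum_l w i * w l * ((countdiff R i s t * countdiff R l s t) *
    (countdiff R i s' t' * countdiff R l s' t')) +
  ((-2 * stat_mean) * stat s t s' t' + stat_mean ^+ 2))); last first.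
  move=> s t s' t'.
  have -> : \sum_i \sum_l w i * w l * ((countdiff R i s t * countdiff R l s t) *
      (countdiff R i s' t' * countdiff R l s' t')) = stat s t s' t' ^+ 2.
    rewrite expr2 {1}/stat mulr_suml; apply: eq_bigr => i _.
    by rewrite mulr_sumr; apply: eq_bigr => l _; ring.
  by ring.
rewrite 2!expect2D expect2_cst expect2Z expect2_stat expect2_sum.
pose g i := w i * gap i ^+ 2.
have -> : \sum_i expect2 (fun s t s' t' => \sum_l w i * w l *
      ((countdiff R i s t * countdiff R l s t) *
      (countdiff R i s' t' * countdiff R l s' t'))) =
    \sum_i (\sum_l Nr ^+ 2 * g i * (Nr ^+ 2 * g l) +
     (2 * (Nr ^+ 2 * (w i * gap i ^+ 2)) * (w i * (Nr * var i)) +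
      (w i * (Nr * var i)) ^+ 2)).
  apply: eq_bigr => i _; rewrite expect2_sum.
  under eq_bigr => l _ do rewrite expect2Z expect2_mul !expect_countdiff2 //.
  rewrite (bigD1 i) //= [in RHS](bigD1 i) //= eqxx.
  rewrite (eq_bigr (fun l => Nr ^+ 2 * g i * (Nr ^+ 2 * g l))); last first.
    by move=> l /negPf li; rewrite eq_sym li /g /=; ring.
  by rewrite /g /=; ring.
rewrite !big_split /= -/(noise).
under eq_bigr do rewrite -mulr_sumr -mulr_sumr.
rewrite -mulr_suml -mulr_sumr /stat_mean /g; ring.
Qed.

(* Chebyshev's inequality; the factor [w * (N * var)] of the cross term is
   bounded by its [l^2] norm, so the weights need no pointwise control. *)
Lemma stat_tail (rho : R) : 0 < rho -> (forall i, 0 <= w i) ->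
  noise <= 25 * rho ^+ 2 -> 100 * rho <= stat_mean ->
  expect2 (fun s t s' t' => (stat s t s' t' <= 3 * rho)%R%:R) <= 11 / 100.
Proof.
move=> rho0 w0 noise_le mean_ge.
(* Each term of [noise] is at most the whole sum. *)
have wv i : w i * (Nr * var i) <= 5 * rho.
  have : (w i * (Nr * var i)) ^+ 2 <= (5 * rho) ^+ 2.
    apply: le_trans (_ : 25 * rho ^+ 2 <= _); last by nra.
    apply: le_trans noise_le; rewrite /noise (bigD1 i) //= lerDl.
    by apply: sumr_ge0 => l _; exact: sqr_ge0.
  rewrite ler_sqr ?nnegrE //; last by nra.
  by rewrite !mulr_ge0 ?var_ge0.
have var_le : expect2 (fun s t s' t' => (stat s t s' t' - stat_mean) ^+ 2) <=
    10 * rho * stat_mean + 25 * rho ^+ 2.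
  rewrite stat_variance; apply: lerD => //.
  rewrite /stat_mean mulrA mulr_sumr; apply: ler_sum => i _.
  have h := wv i; have : 0 <= Nr ^+ 2 * (w i * gap i ^+ 2).
    by apply: mulr_ge0; [exact: sqr_ge0 | apply: mulr_ge0 => //;
      exact: sqr_ge0].
  by nra.
have d0 : 0 < (stat_mean - 3 * rho) ^+ 2 by rewrite exprn_gt0 // subr_gt0; nra.
(* The ratio decreases in the mean, and at mean 100 rho it equals 1025 / 97 ^ 2 < 11 / 100. *)
apply: le_trans (_ : ((stat_mean - 3 * rho) ^+ 2)^-1 *
    (10 * rho * stat_mean + 25 * rho ^+ 2) <= _); last first.
  by rewrite mulrC ler_pdivrMr //; nra.
apply: le_trans (_ : expect2 (fun s t s' t' => ((stat_mean - 3 * rho) ^+ 2)^-1 *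
    (stat s t s' t' - stat_mean) ^+ 2) <= _); last first.
  by rewrite expect2Z ler_wpM2l // invr_ge0 ltW.
apply: ler_expect2 => s t s' t'; case: (lerP (stat s t s' t') (3 * rho)) => h.
  by rewrite mulrC ler_pdivlMr // mul1r; nra.
by rewrite mulr_ge0 ?sqr_ge0 // invr_ge0 ltW.
Qed.

End FixedWeights.

Definition wgt (s t : seq T) (i : 'I_n) : R := (N.+1 %/ (ndiff i s t).+1)%:R.

Lemma wgt_ge0 s t i : 0 <= wgt s t i. Proof. exact: ler0n. Qed.

Lemma wgt_le s t i : wgt s t i <= N.+1%:R / (ndiff i s t).+1%:R.
Proof. by rewrite ler_pdivlMr ?ltr0n // -natrM ler_nat leq_trunc_div. Qed.

(** [ndiff <= N] makes the quotient at least 1, so rounding down loses at most a factor 2. *)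
Lemma wgt_ge s t i : size s = N -> size t = N ->
  N.+1%:R / (ndiff i s t).+1%:R <= 2 * wgt s t i.
Proof.
move=> ss st; have V_le := ndiff_le i ss st.
rewrite ler_pdivrMr ?ltr0n // -!natrM ler_nat.
set d := (ndiff i s t).+1; have q0 : (0 < N.+1 %/ d)%N by rewrite divn_gt0.
by have := ltn_ceil N.+1 (isT : (0 < d)%N); nia.
Qed.

(** Bounding [var] by [disagree] and [wgt] by the exact quotient leaves [binexp_inv2_le] in each
    coordinate. *)
Lemma expect_noise : E (fun s t => noise (wgt s t)) <= 2 * (Nr ^+ 2 * n%:R).
Proof.
rewrite /noise expect_sum //.
apply: le_trans (_ : \sum_(i < n) Nr ^+ 2 * 2 <= _); last first.
  by rewrite sumr_const card_ord -mulr_natr; nra.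
apply: ler_sum => i _.
have Nge0 : 0 <= Nr by exact: ler0n.
have [b0 b1] := andP (disagree01 prodP prodQ i).
have v0 := var_ge0 prodP prodQ i; have vb := var_le P Q i.
apply: le_trans (_ : Nr ^+ 2 * (disagree i ^+ 2 *
    E (fun s t => (N.+1%:R / (ndiff i s t).+1%:R) ^+ 2)) <= _); last first.
  apply: ler_wpM2l; first exact: sqr_ge0.
  rewrite (expect_ndiff prodP prodQ N i (fun k => (N.+1%:R / k.+1%:R) ^+ 2)).
  exact: binexp_inv2_le (disagree01 prodP prodQ i) N.
rewrite -!expectZ; apply: ler_expect => // s t _ _.
have := wgt_le s t i; have := wgt_ge0 s t i.
move: (wgt s t i) (N.+1%:R / _) => x y x0 xy.
have : x * (Nr * var i) <= y * (Nr * disagree i).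
  by apply: ler_pM => //; [exact: mulr_ge0 | exact: ler_wpM2l].
have x1 : 0 <= x * (Nr * var i) by rewrite !mulr_ge0.
move=> le1; have y1 := le_trans x1 le1.
rewrite [leRHS](_ : _ = (y * (Nr * disagree i)) ^+ 2); last by ring.
by rewrite ler_sqr.
Qed.

(** Without gaps the conditional mean is 0 and the conditional variance is [noise], so Chebyshev's
    inequality gives 2 / 9. *)
Lemma null_tail : (forall i, gap i = 0) ->
  E (fun s t => expect2 (fun s1 t1 s2 t2 =>
      (9 * (Nr ^+ 2 * n%:R) < stat (wgt s t) s1 t1 s2 t2 ^+ 2)%R%:R)) <= 1 / 3.
Proof.
move=> gap0.
have mean0 s t : stat_mean (wgt s t) = 0.
  by rewrite /stat_mean big1 ?mulr0 // => i _; rewrite gap0 expr0n mulr0.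
have rho0 : 0 < Nr ^+ 2 * n%:R by rewrite mulr_gt0 ?exprn_gt0 ?ltr0n.
apply: le_trans (_ : (9 * (Nr ^+ 2 * n%:R))^-1 * (2 * (Nr ^+ 2 * n%:R)) <= _).
  apply: le_trans (_ : (9 * (Nr ^+ 2 * n%:R))^-1 * E (fun s t =>
    noise (wgt s t)) <= _).
    rewrite -expectZ; apply: ler_expect => // s t _ _.
    have <- : expect2 (fun s1 t1 s2 t2 => stat (wgt s t) s1 t1 s2 t2 ^+ 2) =
        noise (wgt s t).
      have := stat_variance (wgt s t); rewrite mean0 big1 ?add0r => [<-|i _].
        by apply: eq_expect2 => *; rewrite subr0.
      by rewrite gap0; ring.
    rewrite -expect2Z; apply: ler_expect2 => s1 t1 s2 t2.
    case: ltrP => h; last by rewrite mulr_ge0 ?sqr_ge0 // invr_ge0; nra.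
    by rewrite mulrC ler_pdivlMr ?mul1r 1?ltW //; nra.
  by apply: ler_wpM2l expect_noise; rewrite invr_ge0; nra.
by rewrite mulrC ler_pdivrMr; nra.
Qed.

Definition signal : R := \sum_i Nr * gap i ^+ 2 / (Nr * disagree i + 1).

Lemma denom_gt0 i : 0 < Nr * disagree i + 1.
Proof.
have [b0 _] := andP (disagree01 prodP prodQ i).
by rewrite ltr_wpDl ?mulr_ge0 ?ler0n.
Qed.

Lemma signal_ge0 : 0 <= signal.
Proof.
apply: sumr_ge0 => i _; apply: mulr_ge0.
  by apply: mulr_ge0; [exact: ler0n | exact: sqr_ge0].
by rewrite invr_ge0; exact: ltW (denom_gt0 i).
Qed.

Definition spread (s t : seq T) : R :=
  \sum_i gap i ^+ 2 * Nr ^+ 2 * (ndiff i s t).+1%:R / (Nr * disagree i + 1) ^+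
    2.

(** [ndiff + 1] has mean N b + 1, which cancels one of the two factors in the denominator. *)
Lemma expect_spread : E spread = Nr * signal.
Proof.
rewrite /spread expect_sum // /signal mulr_sumr; apply: eq_bigr => i _.
have z0 := lt0r_neq0 (denom_gt0 i).
rewrite (@eq_expect _ _ _ _ _ _ (fun s t => gap i ^+ 2 * Nr ^+ 2 /
    (Nr * disagree i + 1) ^+ 2 * (ndiff i s t).+1%:R)); last first.
  by move=> s t _ _; rewrite mulrAC.
rewrite expectZ (expect_ndiff prodP prodQ N i (fun k => k.+1%:R)).
rewrite (_ : binexp _ _ _ = Nr * disagree i + 1); first by field.
rewrite -binexp_id -[X in _ = _ + X](binexp_cst (disagree i) N) -binexpD.
by apply: eq_binexp => k; rewrite -natr1.
Qed.

(* Markov's inequality for [spread] replaces a lower tail bound on the weights: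
   by AM-GM, [2 / z <= 10 / v + v / (10 z ^ 2)] for [v = ndiff + 1] and
   [z = N * disagree + 1]. *)
Lemma weighted_gap_ge s t : size s = N -> size t = N ->
  spread s t <= 10 * (Nr * signal) ->
  signal <= 20 * \sum_i wgt s t i * gap i ^+ 2.
Proof.
move=> ss st sp.
have amgm : 2 * signal <= 10 * Nr * \sum_i gap i ^+ 2 / (ndiff i s t).+1%:R
    + (10 * Nr)^-1 * spread s t.
  rewrite /signal /spread !mulr_sumr -big_split; apply: ler_sum => i _ /=.
  have z0 := denom_gt0 i; have y0 : 0 < (ndiff i s t).+1%:R :> R
    by rewrite ltr0n.
  move: (Nr * disagree i + 1) ((ndiff i s t).+1%:R : R) z0 y0 => z y z0 y0.
  have := N0; move: Nr => M M0; rewrite -subr_ge0.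
  have -> : 10 * M * (gap i ^+ 2 / y) + (10 * M)^-1 * (gap i ^+ 2 * M ^+ 2 * y
    / z ^+ 2)
     - 2 * (M * gap i ^+ 2 / z) =
     M * gap i ^+ 2 * (10 * z - y) ^+ 2 / (10 * y * z ^+ 2).
    by field; rewrite !lt0r_neq0.
  apply: divr_ge0; last by apply: mulr_ge0; [lra | exact: sqr_ge0].
  by apply: mulr_ge0; [apply: mulr_ge0; [exact: ltW |] |]; exact: sqr_ge0.
have le1 : (10 * Nr)^-1 * spread s t <= signal.
  by rewrite mulrC ler_pdivrMr; have := N0; nra.
have le2 : Nr * \sum_i gap i ^+ 2 / (ndiff i s t).+1%:R <=
    2 * \sum_i wgt s t i * gap i ^+ 2.
  rewrite !mulr_sumr; apply: ler_sum => i _.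
  have := wgt_ge i ss st; have g2 := sqr_ge0 (gap i).
  have : Nr / (ndiff i s t).+1%:R <= N.+1%:R / (ndiff i s t).+1%:R.
    by rewrite ler_wpM2r ?invr_ge0 ?ler0n // ler_nat.
  move=> /le_trans h /h {}h; have := ler_wpM2r g2 h; congr (_ <= _); ring.
by lra.
Qed.

(** A union bound of total 2 / 25 + 1 / 10 + 11 / 100 < 1 / 3. When [noise] or [spread] is too
    large, its Markov term in [bound] is already at least 1; otherwise [stat_tail] applies. *)
Lemma alt_tail (rho : R) : rho ^+ 2 = Nr ^+ 2 * n%:R -> 0 < rho ->
  2000 * rho <= Nr ^+ 2 * signal ->
  E (fun s t => expect2 (fun s1 t1 s2 t2 =>
      (stat (wgt s t) s1 t1 s2 t2 <= 3 * rho)%R%:R)) <= 1 / 3.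
Proof.
move=> rhoE rho0 sig_ge.
have sig0 : 0 < signal.
  rewrite lt0r signal_ge0 andbT; apply: contraTneq sig_ge => ->.
  by rewrite mulr0 -ltNge mulr_gt0.
have Nsig0 : 0 < Nr * signal by exact: mulr_gt0.
have rho2 : 0 < rho ^+ 2 by rewrite exprn_gt0.
pose bound s t := (25 * rho ^+ 2)^-1 * noise (wgt s t) +
  ((10 * (Nr * signal))^-1 * spread s t + 11 / 100).
apply: le_trans (_ : E bound <= _); last first.
  rewrite /bound !expectD !expectZ expect_cst // expect_spread.
  have := expect_noise; rewrite -rhoE => en.
  have : (25 * rho ^+ 2)^-1 * E (fun s t => noise (wgt s t)) <= 2 / 25.
    by rewrite mulrC ler_pdivrMr; nra.
  have -> : (10 * (Nr * signal))^-1 * (Nr * signal) = 1 / 10.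
    by field; rewrite !lt0r_neq0.
  by lra.
apply: ler_expect => // s t ss st; rewrite /bound.
have noise0 : 0 <= (25 * rho ^+ 2)^-1 * noise (wgt s t).
  rewrite mulr_ge0 ?invr_ge0 //; first by nra.
  by apply: sumr_ge0 => i _; exact: sqr_ge0.
have spread0 : 0 <= (10 * (Nr * signal))^-1 * spread s t.
  rewrite mulr_ge0 ?invr_ge0 //; first by nra.
  apply: sumr_ge0 => i _; apply: divr_ge0; last exact: sqr_ge0.
  by apply: mulr_ge0; [apply: mulr_ge0; exact: sqr_ge0 | exact: ler0n].
have le1 : expect2 (fun s1 t1 s2 t2 =>
      (stat (wgt s t) s1 t1 s2 t2 <= 3 * rho)%R%:R) <= 1.
  by rewrite -[leRHS]expect2_cst; apply: ler_expect2 => *; rewrite lern1;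
    exact: leq_b1.
have [noise_le|noise_gt] := lerP (noise (wgt s t)) (25 * rho ^+ 2); last first.
  have : 1 <= (25 * rho ^+ 2)^-1 * noise (wgt s t).
    by rewrite mulrC ler_pdivlMr ?mul1r 1?ltW //; nra.
  by lra.
have [spread_le|spread_gt] := lerP (spread s t) (10 * (Nr * signal));
  last first.
  have : 1 <= (10 * (Nr * signal))^-1 * spread s t.
    by rewrite mulrC ler_pdivlMr ?mul1r 1?ltW //; nra.
  by lra.
have := weighted_gap_ge ss st spread_le => wg.
(* The factor 20 lost in [weighted_gap_ge] turns 2000 rho into 100 rho. *)
have mean_ge : 100 * rho <= stat_mean (wgt s t).
  rewrite /stat_mean; move: wg; set S := \sum_i _ => wg.
  have := ler_wpM2l (sqr_ge0 Nr) wg; lra.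
have := stat_tail rho0 (wgt_ge0 s t) noise_le mean_ge.
by lra.
Qed.

End Tails.

(** * The total variation distance of product distributions *)

Lemma one_sub_prod_le (R : realDomainType) (I : Type) (r : seq I) (t : I -> R) :
  (forall i, 0 <= t i <= 1) ->
  1 - \prod_(i <- r) t i <= \sum_(i <- r) (1 - t i).
Proof.
move=> t01; have [] // : 0 <= \prod_(i <- r) t i <= 1 /\
    1 - \prod_(i <- r) t i <= \sum_(i <- r) (1 - t i).
elim: r => [|i r [/andP[p0 p1] IH]]; first by rewrite !big_nil subrr lexx ler01.
by rewrite !big_cons; have /andP[t0 t1] := t01 i; split; nra.
Qed.

Section ProductL1.
Variables (R : realType) (n : nat).
Implicit Types f g : 'I_n -> bool -> R.

Definition is_marginals f := forall i, (forall b, 0 <= f i b) /\ \sum_b f i b =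
  1.

Definition prod_l1 f g : R :=
  \sum_(x : n.-tuple bool)
    `|\prod_i f i (tnth x i) - \prod_i g i (tnth x i)|.

(** The Bhattacharyya coefficient of coordinate [i]; its distance to 1 is the squared Hellinger
    distance. *)
Definition affinity f g i : R := \sum_b Num.sqrt (f i b) * Num.sqrt (g i b).

Lemma sum_prod1 f : is_marginals f ->
  \sum_(x : n.-tuple bool) \prod_i f i (tnth x i) = 1.
Proof. by move=> mf; rewrite sum_prod_tuple big1 // => i _; case: (mf i). Qed.

Lemma affinity01 f g i : is_marginals f -> is_marginals g ->
  0 <= affinity f g i <= 1.
Proof.
move=> /(_ i)[f0 f1] /(_ i)[g0 g1]; apply/andP; split.
  by apply: sumr_ge0 => b _; rewrite mulr_ge0 ?sqrtr_ge0.
have -> : 1 = \sum_b (f i b + g i b) / 2.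
  by rewrite -mulr_suml big_split /= f1 g1; lra.
apply: ler_sum => b _; have ex := sqr_sqrtr (f0 b); have ey := sqr_sqrtr (g0 b).
rewrite -{2}ex -{2}ey.
by have := sqr_ge0 (Num.sqrt (f i b) - Num.sqrt (g i b)); lra.
Qed.

(* [|a^2 - b^2| <= (c (a - b)^2 + (a + b)^2 / c) / 2] summed over all points,
   with [a], [b] the square roots of the two densities. *)
Lemma prod_l1_hellinger f g (c : R) : is_marginals f -> is_marginals g ->
  0 < c -> prod_l1 f g <= c * \sum_i (1 - affinity f g i) + 2 / c.
Proof.
move=> mf mg c0.
pose a (x : n.-tuple bool) := \prod_i Num.sqrt (f i (tnth x i)).
pose b (x : n.-tuple bool) := \prod_i Num.sqrt (g i (tnth x i)).
have aE x : \prod_i f i (tnth x i) = a x ^+ 2.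
  rewrite -prodrXl; apply: eq_bigr => i _; rewrite sqr_sqrtr //.
  by case: (mf i).
have bE x : \prod_i g i (tnth x i) = b x ^+ 2.
  rewrite -prodrXl; apply: eq_bigr => i _; rewrite sqr_sqrtr //.
  by case: (mg i).
have a0 x : 0 <= a x by apply: prodr_ge0 => i _; exact: sqrtr_ge0.
have b0 x : 0 <= b x by apply: prodr_ge0 => i _; exact: sqrtr_ge0.
have suma : \sum_x a x ^+ 2 = 1.
  by rewrite -(sum_prod1 mf); apply: eq_bigr => x _; rewrite aE.
have sumb : \sum_x b x ^+ 2 = 1.
  by rewrite -(sum_prod1 mg); apply: eq_bigr => x _; rewrite bE.
(* The affinity is multiplicative over independent coordinates. *)
have sumab : \sum_x a x * b x = \prod_i affinity f g i.
  rewrite -(sum_prod_tuple (fun i b => Num.sqrt (f i b) * Num.sqrt (g i b))).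
  by apply: eq_bigr => x _; rewrite big_split.
have af01 i := affinity01 i mf mg.
have bc0 : 0 <= \prod_i affinity f g i by apply: prodr_ge0 => i _;
  case/andP: (af01 i).
have bcle : 1 - \prod_i affinity f g i <= \sum_i (1 - affinity f g i).
  exact: one_sub_prod_le.
have bc1 : \prod_i affinity f g i <= 1.
  by apply: prodr_ile1 => i _; exact: af01.
apply: le_trans (_ : c * (1 - \prod_i affinity f g i) +
    c^-1 * (1 + \prod_i affinity f g i) <= _); last first.
  apply: lerD; first by rewrite ler_pM2l.
  by rewrite [leRHS]mulrC ler_pM2l ?invr_gt0 //; lra.
rewrite -sumab.
have -> : c * (1 - \sum_x a x * b x) + c^-1 * (1 + \sum_x a x * b x) =
    \sum_x (c / 2 * (a x - b x) ^+ 2 + c^-1 / 2 * (a x + b x) ^+ 2).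
  transitivity (\sum_x ((c / 2 + c^-1 / 2) * a x ^+ 2 +
      ((c / 2 + c^-1 / 2) * b x ^+ 2 + (c^-1 - c) * (a x * b x)))).
    rewrite !big_split /= -!mulr_sumr suma sumb.
    by field; rewrite lt0r_neq0.
  by apply: eq_bigr => x _; field; rewrite lt0r_neq0.
apply: ler_sum => x _; rewrite aE bE.
have -> : a x ^+ 2 - b x ^+ 2 = (a x - b x) * (a x + b x) by ring.
rewrite normrM (ger0_norm (addr_ge0 (a0 x) (b0 x))) -(real_normK (num_real (a x
  - b x))).
move: `|_| (a x + b x) => u v.
have -> : c / 2 * u ^+ 2 + c^-1 / 2 * v ^+ 2 = u * v + (c * u - v) ^+ 2 / (2 *
  c).
  by field; rewrite lt0r_neq0.
by rewrite lerDl divr_ge0 ?sqr_ge0 //; lra.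
Qed.

End ProductL1.

(** One coordinate is exchanged at a time: f0 F - g0 G = (f0 - g0) F + g0 (F - G), where F and g0
    have total mass 1. *)
Lemma prod_l1_subadditive (R : realType) (n : nat) (f g : 'I_n -> bool -> R) :
  is_marginals f -> is_marginals g ->
  prod_l1 f g <= \sum_i \sum_b `|f i b - g i b|.
Proof.
elim: n f g => [|n IH] f g mf mg.
  by rewrite /prod_l1 sum_tuple0 !big_ord0 subrr normr0.
pose f' i := f (lift ord0 i); pose g' i := g (lift ord0 i).
have mf' : is_marginals f' by move=> i; exact: mf.
have mg' : is_marginals g' by move=> i; exact: mg.
rewrite big_ord_recl /prod_l1 sum_tupleS.
pose F (t : n.-tuple bool) := \prod_i f' i (tnth t i).
pose G (t : n.-tuple bool) := \prod_i g' i (tnth t i).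
have F0 t : 0 <= F t by apply: prodr_ge0 => i _; case: (mf' i).
apply: le_trans (_ : \sum_b \sum_t (`|f ord0 b - g ord0 b| * F t +
    g ord0 b * `|F t - G t|) <= _).
  apply: ler_sum => b _; apply: ler_sum => t _.
  rewrite !big_ord_recl !tnth0.
  under eq_bigr do rewrite tnthS.
  under [X in _ - _ * X]eq_bigr do rewrite tnthS.
  rewrite -/(F t) -/(G t).
  rewrite (_ : _ - _ = (f ord0 b - g ord0 b) * F t + g ord0 b * (F t - G t));
    last by ring.
  apply: le_trans (ler_normD _ _) _; rewrite !normrM (ger0_norm (F0 t)).
  by rewrite (ger0_norm (_ : 0 <= g ord0 b)) //; case: (mg ord0).
under eq_bigr do rewrite big_split /= -!mulr_sumr (sum_prod1 mf') mulr1.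
rewrite big_split /= -mulr_suml; case: (mg ord0) => _ ->; rewrite mul1r lerD2l.
exact: IH.
Qed.

(** * Lower bound on the signal of a far pair *)

Section SignalLowerBound.
Variables (R : realType) (n : nat) (P Q : {ffun n.-tuple bool -> R}).
Hypotheses (prodP : product_dist P) (prodQ : product_dist Q).
Variable N : nat.
Hypotheses (n_gt0 : (0 < n)%N) (N_gt0 : (0 < N)%N).
Local Notation gap := (gap P Q).
Local Notation disagree := (disagree P Q).
Local Notation Nr := (N%:R : R).

Lemma is_marginals_marginal (S : {ffun n.-tuple bool -> R}) :
  product_dist S -> is_marginals (marginal S).
Proof.
by move=> hS i; split=> [b|]; [exact: marginal_ge0 | exact: marginal_sum1].
Qed.

(** 1 minus the affinity is half the sum of (u - v) ^ 2 over two pairs of square roots. For both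
    pairs b <= u ^ 2 + v ^ 2 <= (u + v) ^ 2, so b (u - v) ^ 2 <= (u ^ 2 - v ^ 2) ^ 2, which is the
    squared gap. *)
Lemma disagree_affinity_le i :
  disagree i * (1 - affinity (marginal P) (marginal Q) i) <= gap i ^+ 2.
Proof.
have [p0 p1] := andP (mean01 prodP i); have [q0 q1] := andP (mean01 prodQ i).
rewrite /affinity big_bool /= !marginal_false // -!/(mean _ _) /disagree /gap.
set p := mean P i in p0 p1 *; set q := mean Q i in q0 q1 *.
have hx := sqrtr_ge0 p; have hy := sqrtr_ge0 q.
have hx' := sqrtr_ge0 (1 - p); have hy' := sqrtr_ge0 (1 - q).
have ex := sqr_sqrtr p0; have ey := sqr_sqrtr q0.
have ex' : Num.sqrt (1 - p) ^+ 2 = 1 - p by rewrite sqr_sqrtr ?subr_ge0.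
have ey' : Num.sqrt (1 - q) ^+ 2 = 1 - q by rewrite sqr_sqrtr ?subr_ge0.
move: (Num.sqrt p) (Num.sqrt q) (Num.sqrt (1 - p)) (Num.sqrt (1 - q))
  hx hy hx' hy' ex ey ex' ey' => x y x' y' hx hy hx' hy' ex ey ex' ey'.
have b0 : 0 <= p + q - 2 * p * q by nra.
have key (u v s : R) : 0 <= u -> 0 <= v -> s <= u ^+ 2 + v ^+ 2 ->
    s * (u - v) ^+ 2 <= (u ^+ 2 - v ^+ 2) ^+ 2.
  move=> u0 v0 hs.
  apply: le_trans (_ : (u ^+ 2 + v ^+ 2) * (u - v) ^+ 2 <= _).
    by apply: ler_wpM2r => //; exact: sqr_ge0.
  rewrite (_ : (u ^+ 2 - v ^+ 2) ^+ 2 = (u + v) ^+ 2 * (u - v) ^+ 2);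
    last by ring.
  by apply: ler_wpM2r; [exact: sqr_ge0 | nra].
have k1 := key x y (p + q - 2 * p * q) hx hy.
have k2 := key x' y' (p + q - 2 * p * q) hx' hy'.
rewrite ex ey in k1; rewrite ex' ey' in k2.
have {}k1 := k1 ltac:(nra); have {}k2 := k2 ltac:(nra).
have -> : 1 - (x * y + x' * y') = ((x - y) ^+ 2 + (x' - y') ^+ 2) / 2.
  have : 1 = (x ^+ 2 + y ^+ 2 + x' ^+ 2 + y' ^+ 2) / 2
    by rewrite ex ey ex' ey'; lra.
  by move=> {1}->; field.
move: k1 k2; set A := (x - y) ^+ 2; set B := (x' - y') ^+ 2; nra.
Qed.

(** The hybrid [h] takes heavy coordinates from Q and light ones from P. By the triangle inequality
    [f] and [h], which differ on heavy coordinates, or [h] and [g], which differ on light ones, are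
    more than eps / 2 apart. *)
Lemma signal_ge (eps : R) : 0 < eps -> eps < l1_dist P Q ->
  eps ^+ 2 / 64 <= signal P Q N \/
  Nr * eps ^+ 2 / (32 * n%:R) <= signal P Q N.
Proof.
move=> eps0 far.
have N0 : 0 < Nr by rewrite ltr0n.
have n0 : 0 < n%:R :> R by rewrite ltr0n.
pose f := marginal P; pose g := marginal Q.
pose heavy i := 1 <= Nr * disagree i.
pose h i := if heavy i then g i else f i.
have mf : is_marginals f by exact: is_marginals_marginal.
have mg : is_marginals g by exact: is_marginals_marginal.
have mh : is_marginals h by move=> i; rewrite /h; case: ifP.
have tri : l1_dist P Q <= prod_l1 f h + prod_l1 h g.
  rewrite /l1_dist /prod_l1 -big_split; apply: ler_sum => x _ /=.
  case: prodP => _ ->; case: prodQ => _ ->.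
  by rewrite -[X in `|X|](subrKA (\prod_i h i (tnth x i))) ler_normD.
pose a i := Nr * gap i ^+ 2 / (Nr * disagree i + 1).
have a0 i : 0 <= a i.
  by rewrite divr_ge0 ?(ltW (denom_gt0 prodP prodQ N i)) // mulr_ge0 ?sqr_ge0
    // ltW.
have [near|] := lerP (prod_l1 f h) (eps / 2); last first.
  move=> far1; left.
  (* With c = 8 / eps the remainder 2 / c is eps / 4, half of the available distance. *)
  have c0 : 0 < 8 / eps by rewrite divr_gt0.
  have := prod_l1_hellinger mf mh c0.
  (* On a heavy coordinate N b + 1 <= 2 N b, hence [a i] is at least d ^ 2 / (2 b). *)
  have le2 : \sum_i (1 - affinity f h i) <= 2 * signal P Q N.
    rewrite /signal mulr_sumr; apply: ler_sum => i _; rewrite -/(a i).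
    rewrite /affinity /h; case: ifP => [hi|_]; last first.
      have -> : \sum_b Num.sqrt (f i b) * Num.sqrt (f i b) = 1.
        case: (mf i) => f0 <-; apply: eq_bigr => b _.
        by rewrite -expr2 sqr_sqrtr.
      by rewrite subrr mulr_ge0.
    rewrite -/(affinity f g i) /a mulrA ler_pdivlMr ?denom_gt0 //.
    have := disagree_affinity_le i; rewrite -/f -/g.
    have /andP[_] := affinity01 i mf mg; rewrite -subr_ge0 /heavy in hi *.
    move: (1 - _) hi => u hi u0 hu.
    have : Nr * (disagree i * u) <= Nr * gap i ^+ 2 by rewrite ler_pM2l.
    by nra.
  have -> : 2 / (8 / eps) = eps / 4 by field; rewrite lt0r_neq0.
  have := ler_wpM2l (ltW c0) le2; set s := signal P Q N => l1 l3.
  have : eps / 4 < 16 * s / eps.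
    have -> : 16 * s / eps = 8 / eps * (2 * s) by field; rewrite lt0r_neq0.
    by lra.
  by rewrite ltr_pdivlMr // => l4; rewrite ler_pdivrMr //; nra.
right; have far2 : eps / 2 < prod_l1 h g by lra.
have := prod_l1_subadditive mh mg.
have k0 : 0 < 4 * n%:R / eps by rewrite divr_gt0 // mulr_gt0.
have le1 : \sum_i \sum_b `|h i b - g i b| <=
    4 * n%:R / eps * (2 * signal P Q N / Nr) + eps / 4.
  (* By AM-GM, 2 |d| <= (4 n / eps) d ^ 2 + eps / (4 n); the last terms sum to eps / 4. On a light
     coordinate N b + 1 < 2, so d ^ 2 <= 2 [a i] / N. *)
  apply: le_trans (_ : \sum_(i < n) (4 * n%:R / eps * (2 * a i / Nr) + eps / (4
    * n%:R)) <= _).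
    apply: ler_sum => i _; rewrite big_bool /= /h; case: ifP => hi.
      rewrite !subrr normr0 addr0; apply: addr_ge0; last first.
        by apply: divr_ge0; [exact: ltW | rewrite mulr_ge0 ?ler0n].
      apply: mulr_ge0; first exact: ltW.
      by apply: divr_ge0; [rewrite mulr_ge0 | exact: ltW].
    rewrite /f /g !marginal_false // (_ : _ - (1 - _) = - gap i);
      last by rewrite /gap; ring.
    rewrite normrN -/(mean P i) -/(mean Q i) -/(gap i).
    have le2 : gap i ^+ 2 <= 2 * a i / Nr.
      rewrite ler_pdivlMr // /a mulrA ler_pdivlMr ?denom_gt0 //.
      move: hi => /negbT; rewrite -ltNge => hi; have := sqr_ge0 (gap i).
      move: (gap i ^+ 2) => u u0; have uN : 0 <= u * Nr
        by rewrite mulr_ge0 // ltW.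
      by nra.
    apply: le_trans (_ : 4 * n%:R / eps * gap i ^+ 2 + eps / (4 * n%:R) <= _);
      last first.
      by rewrite lerD2r ler_wpM2l // ltW.
    rewrite -(real_normK (num_real (gap i))); move: `|gap i| => u.
    rewrite -subr_ge0 (_ : _ - _ = (4 * n%:R * u - eps) ^+ 2 / (4 * n%:R *
      eps)).
      by rewrite divr_ge0 ?sqr_ge0 // mulr_ge0 ?(ltW eps0) // mulr_ge0 // ltW.
    by field; rewrite !lt0r_neq0.
  rewrite big_split /= -mulr_sumr -mulr_suml -mulr_sumr.
  rewrite sumr_const card_ord -[X in _ + X]mulr_natr lerD2l.
  by rewrite (_ : _ * _ = eps / 4) //; field; rewrite lt0r_neq0.
set s := signal P Q N in le1 * => l2.
have : eps / 4 < 4 * n%:R / eps * (2 * s / Nr) by lra.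
have -> : 4 * n%:R / eps * (2 * s / Nr) = 8 * n%:R * s / (eps * Nr).
  by field; rewrite !lt0r_neq0.
rewrite ltr_pdivlMr ?mulr_gt0 // => l3.
by rewrite ler_pdivrMr ?mulr_gt0 //; nra.
Qed.

End SignalLowerBound.

(** * Acceptance probability *)

Lemma ones_block (s1 l s2 : seq (seq bool)) i :
  ones (s1 ++ (l ++ s2)) (size s1) (size l) i = (\sum_(x <- l) nth false x i)%N.
Proof.
rewrite /ones (big_nth [::]) big_nat [RHS]big_nat;
  apply: eq_bigr => j /andP[_ jl].
by rewrite /bit nth_cat ltnNge leq_addr /= addKn nth_cat jl.
Qed.

Lemma diffs_block (l l' u u' : seq (seq bool)) i : size l = size u ->
  diffs (l ++ l') (u ++ u') (size l) i =
  (\sum_(xy <- zip l u) (nth false xy.1 i != nth false xy.2 i))%N.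
Proof.
move=> lu; rewrite /diffs (big_nth ([::], [::])) size_zip -lu minnn.
rewrite big_nat [RHS]big_nat; apply: eq_bigr => j /andP[_ jl].
rewrite nth_zip // /bit !nth_cat -lu jl /=.
by case: (nth false _ i) (nth false _ i) => -[].
Qed.

Lemma zip_map2 (A B C D : Type) (f : A -> C) (g : B -> D) s t :
  zip (map f s) (map g t) = [seq (f xy.1, g xy.2) | xy <- zip s t].
Proof. by elim: s t => [|x s IH] [|y t] //=; rewrite IH. Qed.

Section Acceptance.
Variables (R : realType) (n : nat).
Local Notation T := (n.-tuple bool).

Definition accepts_tuples (N : nat) (s t : seq T) : bool :=
  accepts [seq tval x | x <- s] [seq tval x | x <- t] N n.

Lemma sum_bits_map (s : seq T) (i : 'I_n) :
  (\sum_(x <- [seq tval x | x <- s]) nth false x i)%N%:R =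
  \sum_(x <- s) (tnth x i)%:R :> R.
Proof.
rewrite big_map natr_sum; apply: eq_bigr => x _.
by rewrite (tnth_nth false).
Qed.

(** The two accumulated parts recombine by (X X' + Y Y') - (X Y' + Y X') = (X - Y) (X' - Y'). *)
Lemma statE N (s t s1 t1 s2 t2 : seq T) :
  size s = N -> size t = N -> size s1 = N -> size t1 = N ->
  size s2 = N -> size t2 = N ->
  let lP := [seq tval x | x <- s ++ (s1 ++ s2)] in
  let lQ := [seq tval x | x <- t ++ (t1 ++ t2)] in
  (plus_part lP lQ N n)%:R - (minus_part lP lQ N n)%:R =
  stat (wgt R N s t) s1 t1 s2 t2.
Proof.
move=> ss st ss1 st1 ss2 st2 lP lQ.
rewrite /plus_part /minus_part !big_mkord !natr_sum -sumrB;
  apply: eq_bigr => i _.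
have ones1 (a b c : seq T) : size a = N -> size b = N ->
    (ones [seq tval x | x <- a ++ (b ++ c)] N N i)%:R =
    \sum_(x <- b) (tnth x i)%:R :> R.
  move=> sa sb; rewrite !map_cat -sum_bits_map.
  rewrite -(ones_block [seq tval x | x <- a] _ [seq tval x | x <- c]).
  by rewrite !size_map sa sb.
have ones2 (a b c : seq T) : size a = N -> size b = N -> size c = N ->
    (ones [seq tval x | x <- a ++ (b ++ c)] (2 * N) N i)%:R =
    \sum_(x <- c) (tnth x i)%:R :> R.
  move=> sa sb sc; rewrite catA -[c in LHS]cats0.
  rewrite 2!map_cat -sum_bits_map -(ones_block [seq tval x | x <- a ++ b] _
    [::]).
  by rewrite !size_map size_cat sa sb sc mul2n addnn !map_cat.
have diffsE : diffs lP lQ N i = ndiff i s t.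
  rewrite /lP /lQ !map_cat -{1}ss -(size_map (@tval n bool) s) diffs_block
    ?size_map ?ss ?st //.
  rewrite zip_map2 big_map; apply: eq_bigr => xy _ /=.
  by rewrite !(tnth_nth false).
rewrite /plus_term /minus_term /weight diffsE !natrM !natrD !natrM.
rewrite !ones1 // !ones2 // /wgt /countdiff; ring.
Qed.


(** [rho] stands for N sqrt n, given by its square. A negative difference, truncated to 0 by the
    program, satisfies the bound anyway. *)
Lemma accepts_stat_le N lP lQ (rho : R) : 0 <= rho ->
  rho ^+ 2 = N%:R ^+ 2 * n%:R -> accepts lP lQ N n ->
  (plus_part lP lQ N n)%:R - (minus_part lP lQ N n)%:R <= 3 * rho.
Proof.
rewrite /accepts; move: (plus_part _ _ _ _) (minus_part _ _ _ _) =>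
  a b rho0 rhoE.
have [ab _|ba] := leqP a b.
  by apply: (@le_trans _ _ 0); [rewrite subr_le0 ler_nat | rewrite mulr_ge0].
rewrite -(ler_nat R) natrX natrM natrM natrX natrB; last exact: ltnW.
rewrite -rhoE => le1; rewrite -ler_sqr ?nnegrE ?mulr_ge0 //.
  by rewrite exprMn (_ : 3 ^+ 2 = 9) //; ring.
by rewrite subr_ge0 ler_nat ltnW.
Qed.

(** A truncated difference is 0 and would be accepted, so rejection forces a positive difference. *)
Lemma rejects_stat_gt N lP lQ : ~~ accepts lP lQ N n ->
  9 * (N%:R ^+ 2 * n%:R) <
  ((plus_part lP lQ N n)%:R - (minus_part lP lQ N n)%:R) ^+ 2 :> R.
Proof.
rewrite /accepts -ltnNge; move: (plus_part _ _ _ _) (minus_part _ _ _ _) => a b.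
have [ab|ba] := leqP a b; first by rewrite (eqP ab) exp0n // ltn0.
rewrite -(ltr_nat R) natrX natrM natrM natrX natrB //; last exact: ltnW.
Qed.

Variables P Q : {ffun T -> R}.
Hypotheses (prodP : product_dist P) (prodQ : product_dist Q).

Let P1 : \sum_x P x = 1. Proof. by case: prodP => -[]. Qed.
Let Q1 : \sum_x Q x = 1. Proof. by case: prodQ => -[]. Qed.
Let P0 x : 0 <= P x. Proof. by case: prodP => -[]. Qed.
Let Q0 x : 0 <= Q x. Proof. by case: prodQ => -[]. Qed.

Definition prob_outcome (N : nat) (b : bool) : R :=
  expect P Q (N + (N + N)) (fun s t => (accepts_tuples N s t == b)%:R).

Lemma prob_outcomeN N b : prob_outcome N b = 1 - prob_outcome N (~~ b).
Proof.
apply/eqP; rewrite eq_sym subr_eq -expectD; apply/eqP.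
rewrite -[LHS](expect_cst P1 Q1 (N + (N + N))); apply: eq_expect => s t _ _.
by case: b (accepts_tuples N s t) => -[]; rewrite /= ?addr0 ?add0r.
Qed.

Lemma prob_outcomeE N b :
  prob_outcome N b = expect P Q N (fun s t => expect2 P Q N (fun s1 t1 s2 t2 =>
    (accepts_tuples N (s ++ (s1 ++ s2)) (t ++ (t1 ++ t2)) == b)%:R)).
Proof.
rewrite /prob_outcome expect_cat; apply: eq_expect => s t _ _.
by rewrite expect_cat.
Qed.

Lemma ler_prob_outcome N b (F : seq T -> seq T -> seq T -> seq T -> seq T ->
  seq T -> bool) :
  (forall s t s1 t1 s2 t2,
    size s = N -> size t = N -> size s1 = N -> size t1 = N ->
    size s2 = N -> size t2 = N ->
    accepts_tuples N (s ++ (s1 ++ s2)) (t ++ (t1 ++ t2)) = b ->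
    F s t s1 t1 s2 t2) ->
  prob_outcome N b <= expect P Q N (fun s t => expect2 P Q N (fun s1 t1 s2 t2 =>
    (F s t s1 t1 s2 t2)%:R)).
Proof.
move=> imp; rewrite prob_outcomeE.
apply: ler_expect => // s t ss st; apply: ler_expect => // s1 t1 ss1 st1.
apply: ler_expect => // s2 t2 ss2 st2.
case: eqP => [e|_]; last exact: ler0n.
by rewrite imp.
Qed.

Lemma prob_reject_null N : (0 < n)%N -> (0 < N)%N -> l1_dist P Q = 0 ->
  prob_outcome N false <= 1 / 3.
Proof.
move=> n0 N0 l10; have PQ x : P x = Q x.
  apply/eqP; rewrite -subr_eq0 -normr_eq0; apply/eqP.
  exact: (psumr_eq0P _ l10).
have gap0 i : gap P Q i = 0.
  by apply/eqP; rewrite subr_eq0; apply/eqP; apply: eq_bigr => x _.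
apply: le_trans (null_tail prodP prodQ n0 N0 gap0).
apply: ler_prob_outcome => s t s1 t1 s2 t2 ss st ss1 st1 ss2 st2 /negbT rej.
by rewrite -statE //; exact: rejects_stat_gt.
Qed.

Lemma prob_accept_far N (rho : R) : (0 < n)%N -> (0 < N)%N -> 0 < rho ->
  rho ^+ 2 = N%:R ^+ 2 * n%:R -> 2000 * rho <= N%:R ^+ 2 * signal P Q N ->
  prob_outcome N true <= 1 / 3.
Proof.
move=> n0 N0 rho0 rhoE sig.
apply: le_trans (alt_tail prodP prodQ n0 N0 rhoE rho0 sig).
apply: ler_prob_outcome => s t s1 t1 s2 t2 ss st ss1 st1 ss2 st2 acc.
by rewrite -statE //; apply: accepts_stat_le => //; exact: ltW.
Qed.

(** Execution is deterministic, so the event of output [b] is decided by [accepts_tuples]; the sum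
    over the empty coin tape has a single term. *)
Lemma out_probE (A : cmd) (eps : R) N b :
  (forall w : tapes n (N + (N + N)) 0,
     exists t, outcome A eps w t (accepts_tuples N w.1.1 w.1.2)) ->
  out_prob A (N + (N + N)) 0 eps P Q b = prob_outcome N b.
Proof.
move=> halts; rewrite /prob_outcome expect_tuples /out_prob big_mkcond.
transitivity (\sum_(w : tapes n (N + (N + N)) 0)
    (\prod_(i < N + (N + N)) P (tnth w.1.1 i)) *
    (\prod_(i < N + (N + N)) Q (tnth w.1.2 i)) *
    (accepts_tuples N w.1.1 w.1.2 == b)%:R).
  apply: eq_bigr => w _; rewrite /tapes_weight expr0 mulr1.
  have [t [s es sE]] := halts w.
  have -> : `[< exists t, outcome A eps w t b >] = (accepts_tuples N w.1.1
    w.1.2 == b).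
    apply/asboolP/eqP => [[t' [s' es' <-]]|<-]; last by exists t, s.
    by have [_ ->] := exec_det es' es.
  by case: eqP; rewrite ?mulr1 ?mulr0.
rewrite (eq_bigr (fun w : tapes n (N + (N + N)) 0 => (fun u =>
    (\prod_(i < N + (N + N)) P (tnth u.1 i)) *
    (\prod_(i < N + (N + N)) Q (tnth u.2 i)) *
    (accepts_tuples N u.1 u.2 == b)%:R) w.1)) //.
rewrite -(pair_big predT predT (fun u (_ : 0.-tuple bool) =>
    (\prod_(i < N + (N + N)) P (tnth u.1 i)) *
    (\prod_(i < N + (N + N)) Q (tnth u.2 i)) *
    (accepts_tuples N u.1 u.2 == b)%:R)) /=.
under eq_bigr do rewrite sum_tuple0.
by rewrite -(pair_big predT predT (fun s t : (N + (N + N)).-tuple T =>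
    (\prod_(i < N + (N + N)) P (tnth s i)) *
    (\prod_(i < N + (N + N)) Q (tnth t i)) *
    (accepts_tuples N s t == b)%:R)).
Qed.

End Acceptance.

(** * Parameters *)

(** Take the least k with 2 ^ k eps >= 1. As eps < 1, this k is positive, and minimality gives 2 ^ k
    eps < 2, so the first nonzero answer is exactly 1. *)
Lemma eps_scale (R : realType) (eps : R) : 0 < eps < 1 ->
  exists k, [/\ forall j, (j < k)%N -> eps_oracle eps j = 0%N,
    eps_oracle eps k = 1%N, eps^-1 <= (2 ^ k)%:R & (2 ^ k)%:R <= 2 / eps].
Proof.
move=> /andP[e0 e1].
have posE k : (0 < eps_oracle eps k)%N = (1 <= 2 ^+ k * eps).
  rewrite /eps_oracle truncn_gt0 //.
have ex : exists k, (0 < eps_oracle eps k)%N.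
  exists (Num.bound eps^-1); rewrite posE -ler_pdivrMr // mul1r.
  apply/ltW; apply: lt_trans (archi_boundP (ltW _)) _;
    first by rewrite invr_gt0.
  by rewrite -natrX ltr_nat ltn_expl.
case: (ex_minnP ex) => k; rewrite posE => hk min_k.
have k0 : (0 < k)%N by case: k hk {min_k} => //; rewrite expr0 mul1r leNgt e1.
have lt2 : 2 ^+ k * eps < 2.
  have : ~~ (0 < eps_oracle eps k.-1)%N by apply/negP => /min_k; lia.
  rewrite posE -ltNge -(prednK k0) exprS => h; rewrite /=; lra.
exists k; split.
- move=> j jk; apply/eqP; rewrite -leqn0 leqNgt; apply/negP => /min_k.
  by rewrite leqNgt jk.
- by apply/eqP; rewrite /eps_oracle truncn_eq ?hk //; apply: le_trans hk.
- by rewrite natrX -[eps^-1]mul1r ler_pdivrMr.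
- by rewrite natrX ler_pdivlMr // ltW.
Qed.

(** n E ^ 2 passes both tests, so the least such number exists and is at most n E ^ 2. *)
Lemma sample_root (n E : nat) : (0 < E)%N -> exists r,
  [/\ forall v, (v < r)%N -> (v ^ 2 < n * E ^ 4 \/ v ^ 4 < n ^ 3 * E ^ 4)%N,
      (n * E ^ 4 <= r ^ 2 /\ n ^ 3 * E ^ 4 <= r ^ 4)%N
    & (r <= n * E ^ 2)%N].
Proof.
move=> E0.
pose ok r := ((n * E ^ 4 <= r ^ 2) && (n ^ 3 * E ^ 4 <= r ^ 4))%N.
have okE : ok (n * E ^ 2)%N.
  rewrite /ok (expnMn _ _ 2) (expnMn _ _ 4) -(expnM E 2 2) -(expnM E 2 4).
  apply/andP; split; apply: leq_mul => //; last by rewrite leq_pexp2l.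
    by case: (posnP n) => [->|n0] //; rewrite expnS expn1 leq_pmulr.
  by case: (posnP n) => [->|n0] //; rewrite leq_pexp2l.
case: (ex_minnP (ex_intro ok _ okE)) => r /andP[h2 h4] min_r.
exists r; split=> //; last exact: min_r.
move=> v vr; have : ~~ ok v by apply/negP => /min_r; rewrite leqNgt vr.
by rewrite negb_and -!ltnNge => /orP.
Qed.

(** [magnitude] is cubic in [z] and enters [cell_bound] with its fourth power, whence the degree
    12. *)
Lemma cell_bound_poly (R : realType) : exists c : nat, forall (x : env) (z : R),
  1 <= z -> (ndim x).+1%:R <= 2 * z -> (invE x)%:R <= 2 * z ->
  (cell_bound x)%:R <= c%:R * z ^+ 12.
Proof.
exists (4 * (400 * (400 * (2 * 4))) ^ 4)%N => x z z1 hn hE.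
have z0 : 0 <= z by lra.
have hM : (magnitude x)%:R <= (400 * (400 * (2 * 4)))%N%:R * z ^+ 3.
  rewrite /magnitude; move: (invE x) hE => e hE; rewrite !natrM.
  have : (ndim x).+1%:R * (e%:R * e%:R) <= 2 * z * (2 * z * (2 * z)).
    by apply: ler_pM; rewrite ?mulr_ge0 ?ler0n // ler_pM ?ler0n.
  move: ((ndim x).+1%:R : R) (e%:R : R) (400%:R : R) (ler0n R 400) =>
    u v q q0 hu.
  rewrite [leLHS](_ : _ = q * q * (u * (v * v))); last by ring.
  rewrite [leRHS](_ : _ = q * q * (2 * z * (2 * z * (2 * z)))); last by ring.
  by rewrite ler_wpM2l // mulr_ge0.
have c0 : 0 <= (400 * (400 * (2 * 4)))%N%:R * z ^+ 3 :> R.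
  by rewrite mulr_ge0 ?ler0n ?exprn_ge0.
rewrite /cell_bound (natrM _ 4) (natrX _ (magnitude x)) (natrM _ 4) (natrX _ _
  4).
rewrite -mulrA ler_pM2l ?ltr0n // (_ : z ^+ 12 = (z ^+ 3) ^+ 4);
  last by rewrite -exprM.
by rewrite -exprMn lerXn2r ?nnegrE ?ler0n.
Qed.

Lemma ltr_sqr_bound (R : realFieldType) (a b : R) :
  0 <= b -> a ^+ 2 < b ^+ 2 -> a < b.
Proof. by move=> b0 h; rewrite ltNge; apply/negP => ba; nra. Qed.

(** r - 1 fails one of the two tests, so with E <= 2 / eps it is below 4 q or 2 p. The missing 1 is
    absorbed because q >= 1 when n > 0, whence the factor 5. *)
Lemma root_le_samples (R : realType) (n E r : nat) (eps : R) : 0 < eps < 1 ->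
  E%:R <= 2 / eps ->
  (forall v, (v < r)%N -> (v ^ 2 < n * E ^ 4 \/ v ^ 4 < n ^ 3 * E ^ 4)%N) ->
  r%:R <= 5 * Num.max (Num.sqrt n%:R / eps ^+ 2) ((n%:R `^ (3 / 4)) / eps).
Proof.
move=> /andP[e0 e1] hE min_r.
set q := Num.sqrt n%:R / _; set p := _ `^ _ / _.
have s0 := sqrtr_ge0 (n%:R : R).
have q0 : 0 <= q by rewrite divr_ge0 // sqr_ge0.
have Mq : q <= Num.max q p by rewrite le_max lexx.
have Mp : p <= Num.max q p by rewrite le_max lexx orbT.
case: r min_r => [_|r /(_ r (ltnSn r)) hr]; first by rewrite mulr_ge0 //; lra.
have n0 : (0 < n)%N by case: n hr {q p s0 q0 Mq Mp} => // -[];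
  rewrite ?exp0n ?mul0n ?ltn0.
have q1 : 1 <= q.
  rewrite ler_pdivlMr ?exprn_gt0 // mul1r; apply: (@le_trans _ _ 1);
    first by nra.
  by rewrite -[leLHS]sqrtr1 ler_wsqrtr // ler1n.
suff : r%:R <= 4 * Num.max q p by rewrite -natr1; lra.
have nn0 : 0 <= n%:R :> R by rewrite ler0n.
have E0 : 0 <= E%:R :> R by rewrite ler0n.
case: hr => hr; apply/ltW.
  apply: (@lt_le_trans _ _ (Num.sqrt n%:R * E%:R ^+ 2)).
    apply: ltr_sqr_bound; first by rewrite mulr_ge0 ?sqr_ge0.
    rewrite exprMn sqr_sqrtr // -exprM -!natrX -natrM ltr_nat //.
  apply: (@le_trans _ _ (4 * q)); last by lra.
  rewrite /q [4 * _]mulrCA ler_wpM2l // (_ : 4 * _ = (2 / eps) ^+ 2).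
    by rewrite lerXn2r ?nnegrE // (le_trans E0).
  by field; rewrite lt0r_neq0.
have p4 : (n%:R `^ (3 / 4)) ^+ 4 = n%:R ^+ 3 :> R.
  rewrite -powR_mulrn ?powR_ge0 // -powRrM (_ :
    3 / 4 * 4%:R = 3%:R) ?powR_mulrn //.
  by field.
have pw0 : 0 <= n%:R `^ (3 / 4) :> R by rewrite powR_ge0.
apply: (@lt_le_trans _ _ (n%:R `^ (3 / 4) * E%:R)).
  apply: ltr_sqr_bound; first by rewrite mulr_ge0.
  apply: ltr_sqr_bound; first exact: sqr_ge0.
  by rewrite -!exprM exprMn p4 -!natrX -natrM ltr_nat.
have p0 : 0 <= p by rewrite divr_ge0 // ltW.
apply: (@le_trans _ _ (2 * p)); last by lra.
by rewrite /p [2 * _]mulrCA ler_wpM2l.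
Qed.

(** E eps >= 1 turns the two tests into sqrt n <= r eps ^ 2 and n ^ (3/2) <= r ^ 2 eps ^ 2, one for
    each alternative. In the first one the constant is 160000 / 64 = 2500 >= 2000. *)
Lemma signal_large (R : realType) (n E r : nat) (eps s : R) :
  let N := (400 * (400 * r))%N in
  (0 < n)%N -> 0 < eps -> eps^-1 <= E%:R ->
  (n * E ^ 4 <= r ^ 2 /\ n ^ 3 * E ^ 4 <= r ^ 4)%N ->
  eps ^+ 2 / 64 <= s \/ N%:R * eps ^+ 2 / (32 * n%:R) <= s ->
  2000 * (N%:R * Num.sqrt n%:R) <= N%:R ^+ 2 * s.
Proof.
move=> N n0 e0 hE [h2 h4] hs.
have nn0 : 0 < n%:R :> R by rewrite ltr0n.
set u := Num.sqrt n%:R; have u0 : 0 < u by rewrite sqrtr_gt0.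
have uE : u ^+ 2 = n%:R by rewrite sqr_sqrtr // ltW.
have Ee : 1 <= E%:R * eps by rewrite -ler_pdivrMr // mul1r.
have r0 : 0 <= r%:R :> R by rewrite ler0n.
have NE : N%:R = 400 * (400 * r%:R) :> R by rewrite /N !natrM.
clearbody N; have N0 : 0 <= N%:R :> R by rewrite ler0n.
have E0 : 0 <= E%:R :> R by rewrite ler0n.
have hr1 : u * E%:R ^+ 2 <= r%:R.
  rewrite -ler_sqr ?nnegrE ?mulr_ge0 ?sqr_ge0 // ?(ltW u0) //.
  by rewrite exprMn uE -exprM -!natrX -natrM ler_nat.
have hr2 : u ^+ 3 * E%:R ^+ 2 <= r%:R ^+ 2.
  rewrite -ler_sqr ?nnegrE ?mulr_ge0 ?sqr_ge0 ?exprn_ge0 // ?(ltW u0) //.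
  rewrite exprMn -exprM mulnC exprM uE -!exprM -!natrX -natrM ler_nat //.
have Ee2 : 1 <= (E%:R * eps) ^+ 2 by rewrite exprn_ege1.
have hr1' : u <= r%:R * eps ^+ 2.
  apply: (@le_trans _ _ (u * (E%:R * eps) ^+ 2));
    first by rewrite ler_peMr // ltW.
  by rewrite exprMn mulrA ler_wpM2r // sqr_ge0.
have hr2' : u ^+ 3 <= r%:R ^+ 2 * eps ^+ 2.
  apply: (@le_trans _ _ (u ^+ 3 * (E%:R * eps) ^+ 2)).
    by rewrite ler_peMr // exprn_ge0 // ltW.
  by rewrite exprMn mulrA ler_wpM2r // sqr_ge0.
rewrite [2000 * _]mulrCA [N%:R ^+ 2]expr2 -mulrA ler_wpM2l //.
case: hs => hs; apply: le_trans (ler_wpM2l N0 hs); rewrite NE.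
  have -> : 400 * (400 * r%:R) * (eps ^+ 2 / 64) = 2500 * (r%:R * eps ^+ 2)
    by field.
  by lra.
have -> : 400 * (400 * r%:R) * (400 * (400 * r%:R) * eps ^+ 2 / (32 * n%:R)) =
    400 * (400 * (5000 * (r%:R ^+ 2 * eps ^+ 2))) / n%:R.
  by field; rewrite lt0r_neq0.
rewrite ler_pdivlMr // -uE; move: (r%:R ^+ 2 * eps ^+ 2) hr2' => w hw.
have u3 : 0 <= u ^+ 3 by rewrite exprn_ge0 // ltW.
rewrite (_ : 2000 * u * u ^+ 2 = 2000 * u ^+ 3); last by ring.
by lra.
Qed.

(** * Dimension zero and assembly of the guarantees *)

Lemma l1_dist_dim0 (R : realType) (n : nat) (P Q : {ffun n.-tuple bool -> R}) :
  n = 0%N -> product_dist P -> product_dist Q -> l1_dist P Q = 0.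
Proof.
move=> n0; subst n => -[_ hP] [_ hQ]; rewrite /l1_dist big1 // => x _.
by rewrite hP hQ !big_ord0 subrr normr0.
Qed.

Lemma prob_reject_dim0 (R : realType) (n : nat) (P Q :
  {ffun n.-tuple bool -> R}) N :
  n = 0%N -> product_dist P -> product_dist Q -> prob_outcome P Q N false = 0.
Proof.
move=> n0 [[_ P1] _] [[_ Q1] _]; rewrite -[RHS](expect_cst P1 Q1 (N + (N + N))).
apply: eq_expect => s t _ _.
by rewrite /accepts_tuples /accepts /plus_part big_geq // n0.
Qed.

Theorem theorem4p16 (R : realType) :
  exists (A : cmd) (C d : nat),
  forall (n : nat) (eps : R), 0 < eps < 1 ->
  exists m K : nat,
    [/\ m%:R <= C%:R * Num.max (Num.sqrt n%:R / eps ^+ 2)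
                               ((n%:R `^ (3 / 4)) / eps),
        (forall w : tapes n m K,
           exists (t : nat) (b : bool),
             outcome A eps w t b /\ t%:R <= C%:R * (n%:R + eps^-1) ^+ d)
      & forall P Q : {ffun n.-tuple bool -> R},
          product_dist P -> product_dist Q ->
          (l1_dist P Q = 0 -> 2 / 3 <= out_prob A m K eps P Q true) /\
          (eps < l1_dist P Q -> 2 / 3 <= out_prob A m K eps P Q false)].
Proof.
have [k run_tester] := tester_runs; have [c poly_bound] := cell_bound_poly R.
(* The constant is hidden behind an equation, so that its unary form is never unfolded. *)
have [C0 C0E] : exists C0, C0 = (15 * (400 * 400))%N by eexists.
have C0R : C0%:R = 15 * (400 * 400) :> R by rewrite C0E !natrM.
(* [C0] bounds the 3 N samples by N = 160000 r and r <= 5 max; [k * c ^ k] and the degree [12 * k]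
   come from inserting [cell_bound_poly] into [polyb k]. *)
exists tester, (C0 + k * c ^ k)%N, (12 * k)%N => n eps eps01.
have /andP[e0 e1] := eps01.
have [ks [orc0 orc1 Ege Ele]] := eps_scale eps01.
have E0 : (0 < 2 ^ ks)%N by rewrite expn_gt0.
have [r [r_min r_ok r_le]] := sample_root n E0.
have [N NE] : exists N, N = (400 * (400 * r))%N by eexists.
exists (N + (N + N))%N, 0%N.
pose env_of (w : tapes n (N + (N + N)) 0) := Env n (eps_oracle eps) ks r
  [seq tval x | x <- tval w.1.1] [seq tval x | x <- tval w.1.2].
clear C0E; have wf_env w : wf (env_of w).
  have sz : (N + (N + N) = 3 * N)%N by rewrite !mulSn mul0n addn0.
  split; [by [] | exact: r_min | exact: r_ok | exact: r_le |].
  rewrite /reps /= -NE; split; rewrite ?size_map ?size_tuple //.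
    by apply/allP => _ /mapP[x _ ->]; rewrite size_tuple.
  by apply/allP => _ /mapP[x _ ->]; rewrite size_tuple.
have halts w : exists2 t, outcome tester eps w t (accepts_tuples N w.1.1 w.1.2)
    & (t <= polyb k (cell_bound (env_of w)))%N.
  have [t [s [es lt accE]]] := run_tester _ (wf_env w); exists t => //.
  exists s; last by rewrite accE /reps /= -NE.
  by rewrite /init_state (_ : tval w.2 = [::]) ?tuple0.
split.
- have := root_le_samples eps01 Ele r_min; set M := Num.max _ _ => rM.
  have M0 : 0 <= M by rewrite le_max divr_ge0 ?sqrtr_ge0 ?sqr_ge0.
  rewrite [in leRHS]natrD mulrDl -[leLHS]addr0.
  apply: lerD; last by rewrite mulr_ge0 ?ler0n.
  rewrite !natrD C0R (_ : N%:R = 400 * (400 * r%:R)); last by rewrite NE !natrM.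
  by clear - rM; lra.
- move=> w; have [t ot lt] := halts w.
  exists t, (accepts_tuples N w.1.1 w.1.2); split=> //.
  have z1 : 1 <= n%:R + eps^-1.
    by rewrite ler_wpDl ?ler0n // -[leLHS]invr1 lef_pV2 ?posrE // ltW.
  set z := n%:R + eps^-1 in z1 *.
  have ie1 : 1 <= eps^-1 by rewrite -[leLHS]invr1 lef_pV2 ?posrE // ltW.
  have nn0 : 0 <= n%:R :> R by rewrite ler0n.
  have hW : (cell_bound (env_of w))%:R <= c%:R * z ^+ 12.
    apply: poly_bound => //=; first by rewrite -natr1 /z; lra.
    by apply: (le_trans Ele); rewrite ler_wpM2l // /z; lra.
  apply: (@le_trans _ _ (polyb k (cell_bound (env_of w)))%:R);
    first by rewrite ler_nat.
  rewrite natrD mulrDl -[leLHS]add0r lerD //.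
    by rewrite mulr_ge0 ?ler0n // exprn_ge0 //; lra.
  rewrite /polyb natrM (natrM _ k) !natrX -mulrA ler_wpM2l ?ler0n // exprM
    -exprMn.
  by rewrite lerXn2r ?nnegrE ?ler0n // mulr_ge0 ?ler0n // exprn_ge0 //; lra.
- move=> P Q prodP prodQ.
  have halts' (w : tapes n (N + (N + N)) 0) :
    exists t, outcome tester eps w t (accepts_tuples N w.1.1 w.1.2).
    by have [t ot _] := halts w; exists t.
  rewrite !(out_probE _ _ _ halts').
  have suff_le b : prob_outcome P Q N (~~ b) <= 1 / 3 -> 2 / 3 <= prob_outcome
    P Q N b.
    by rewrite (prob_outcomeN prodP prodQ N b); lra.
  (* For n = 0 there are no repetitions and Chebyshev's inequality has nothing to divide by; the
     distributions coincide and the tester accepts. *)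
  have [n0|n_gt0] := posnP n.
    rewrite (l1_dist_dim0 n0) //; split=> [_|]; last by rewrite ltNge ltW.
    by apply: suff_le; rewrite prob_reject_dim0 //; lra.
  have N_gt0 : (0 < N)%N.
    rewrite NE !muln_gt0 /= lt0n; apply: contraTneq (proj1 r_ok) => ->.
    by rewrite exp0n // -ltnNge muln_gt0 n_gt0 expn_gt0 E0.
  split=> [null|far]; apply: suff_le; first exact: prob_reject_null.
  apply: (@prob_accept_far _ _ _ _ _ _ _ (N%:R * Num.sqrt n%:R)) => //.
  - by rewrite mulr_gt0 ?sqrtr_gt0 ?ltr0n.
  - by rewrite exprMn sqr_sqrtr ?ler0n.
  - have far' := signal_ge prodP prodQ n_gt0 N_gt0 e0 far.
    by rewrite NE in far' *; exact: signal_large r_ok far'.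
Qed.
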